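(* Let $k$ and $\ell$ be integers with $k\ge 3$ and $\ell \ge e^{4k^{(k+6)k}}$, and let $G=(V_1\cup \ldots \cup V_{\ell},E)$ be a balanced $\ell$-partite graph on $n$ vertices such that \[ d(V_i,V_j) \ge \tfrac{k-2}{k-1} \quad \text{for all } i \ne j. \] Then either $G$ is isomorphic to a graph in $\mathcal{G}_{\ell}^{k}$, or $G$ contains a copy of $K_{k-1}^{+}(\lfloor c \ln n \rfloor)$, where $c=k^{-(k+6)k}/2$.
   Context: All graphs are finite, simple and undirected. An $\ell$-partite graph $G=(V_1\cup\ldots\cup V_\ell,E)$ is a graph whose vertex set is the disjoint union of non-empty independent sets $V_1,\ldots,V_\ell$ (its parts); it is balanced if all $V_i$ have the same size. The edge density is $d(V_i,V_j)=\frac{e(V_i,V_j)}{|V_i||V_j|}$. A copy of a graph $H$ in $G$ is a (not necessarily induced) subgraph of $G$ isomorphic to $H$. For an integer $s\ge2$, $K_{k-1}(s)$ is the complete $(k-1)$-partite graph with all classes of size $s$, and $K_{k-1}^+(s)$ is obtained from $K_{k-1}(s)$ by adding one edge inside the first class. The family $\mathcal{G}_\ell^k$ (for $k\ge3$, $\ell\ge(k-1)!$): let $\pi_1,\ldots,\pi_{(k-1)!}$ be all permutations of $\{1,\ldots,k-1\}$. A graph is in $\bar{\mathcal G}_\ell^k$ if it can be constructed as follows. Pick non-negative integers $n_i^{s}$ ($1\le i\le\ell$, $1\le s\le k-1$) such that $n_i^{\pi_i(1)}\ge n_i^{\pi_i(2)}\ge\ldots\ge n_i^{\pi_i(k-1)}$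 for $1\le i\le(k-1)!$; $n_i^1=n_i^2=\ldots=n_i^{k-1}>0$ for $(k-1)!<i\le\ell$; and $\sum_s n_i^s>0$ for $1\le i\le\ell$. The vertex set is $\{(i,s,t):1\le i\le\ell,\ 1\le s\le k-1,\ 1\le t\le n_i^s\}$ and the edge set is $\{(i,s,t)(i',s',t'): i\ne i',\ s\ne s'\}$. Then $\mathcal G_\ell^k$ is the family of graphs which can be obtained from graphs in $\bar{\mathcal G}_\ell^k$ by removing some (possibly no) edges in $\{(i,s,t)(i',s',t'):1\le i<i'\le(k-1)!\}$. *)

(* Defs.v *)
From HB Require Import structures.
From mathcomp Require Import all_boot all_order all_fingroup all_algebra.
Set Implicit Arguments.
Unset Strict Implicit.
Unset Printing Implicit Defensive.
Import Order.TTheory GRing.Theory Num.Theory.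

Record sgraph := SGraph {
  svertex :> finType;
  adj : rel svertex;
  adj_sym : symmetric adj;
  adj_irr : irreflexive adj }.

Arguments adj {s} x y.

Definition isomorphic (G H : sgraph) : Prop :=
  exists2 f : G -> H, bijective f & forall x y, adj (f x) (f y) = adj x y.

Definition contains_copy (G H : sgraph) : Prop :=
  exists2 f : H -> G, injective f & forall x y, adj x y -> adj (f x) (f y).

Record multipartite (G : sgraph) (l : nat) (V : 'I_l -> {set G}) : Prop := {
  parts_cover : \bigcup_i V i = [set: G];
  parts_disjoint : forall i j, i != j -> [disjoint V i & V j];
  parts_nonempty : forall i, V i != set0;
  parts_independent : forall i x y, x \in V i -> y \in V i -> ~~ adj x y }.

Definition balanced (G : sgraph) (l : nat) (V : 'I_l -> {set G}) : Prop :=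
  forall i j, #|V i| = #|V j|.

(* For disjoint A and B every edge between them is counted exactly once. *)
Definition edges_between (G : sgraph) (A B : {set G}) : nat :=
  #|[set p in setX A B | adj p.1 p.2]|.

Definition density (R : numFieldType) (G : sgraph) (A B : {set G}) : R :=
  ((edges_between A B)%:R / (#|A|%:R * #|B|%:R))%R.

Definition Kmulti_adj (r s : nat) : rel ('I_r * 'I_s) :=
  fun x y => x.1 != y.1.

(* The added edge joins (0, 0) and (0, 1); this requires r >= 1 and s >= 2. *)
Definition Kplus_adj (r s : nat) : rel ('I_r * 'I_s) :=
  fun x y => Kmulti_adj x y ||
    [&& x.1 == 0 :> nat, y.1 == 0 :> nat &
        ((x.2 == 0 :> nat) && (y.2 == 1 :> nat)) ||
        ((x.2 == 1 :> nat) && (y.2 == 0 :> nat))].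

Lemma Kplus_sym r s : symmetric (@Kplus_adj r s).
Proof.
move=> x y; rewrite /Kplus_adj /Kmulti_adj (eq_sym x.1) andbCA orbC.
by rewrite [in RHS]orbC (andbC (y.2 == _ :> nat)) [in LHS]orbC [in RHS]orbC
  [X in [&& _, _ & X]]orbC (andbC (y.2 == _ :> nat)).
Qed.

Lemma Kplus_irr r s : irreflexive (@Kplus_adj r s).
Proof.
move=> x; rewrite /Kplus_adj /Kmulti_adj eqxx /=.
by case: (nat_of_ord x.2) => [|n]; rewrite !andbF.
Qed.

Definition Kplus (r s : nat) : sgraph := SGraph (@Kplus_sym r s) (@Kplus_irr r s).

(* Throughout, the indices i, s, t and the positions permuted by pi start
   from 0, and pi enumerates the permutations of 'I_(k - 1). *)
Definition admissible (k l : nat) (pi : 'I_(k.-1)`! -> 'S_k.-1)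
    (n : 'I_l -> 'I_k.-1 -> nat) : Prop :=
  [/\ forall (i : 'I_l) (lti : i < (k.-1)`!) (a b : 'I_k.-1), a <= b ->
        n i (pi (Ordinal lti) b) <= n i (pi (Ordinal lti) a),
      forall i : 'I_l, (k.-1)`! <= i ->
        (forall s s', n i s = n i s') /\ (forall s, 0 < n i s)
    & forall i, 0 < \sum_s n i s].

Definition blowup (k l : nat) (n : 'I_l -> 'I_k.-1 -> nat) : finType :=
  {i : 'I_l & {s : 'I_k.-1 & 'I_(n i s)}}.

Definition part_of k l (n : 'I_l -> 'I_k.-1 -> nat) (x : blowup n) : 'I_l :=
  tag x.

Definition class_of k l (n : 'I_l -> 'I_k.-1 -> nat) (x : blowup n) : 'I_k.-1 :=
  tag (tagged x).

Definition Gbar_adj k l (n : 'I_l -> 'I_k.-1 -> nat) : rel (blowup n) :=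
  fun x y => (part_of x != part_of y) && (class_of x != class_of y).

Inductive Gfamily (k l : nat) (pi : 'I_(k.-1)`! -> 'S_k.-1) : sgraph -> Prop :=
  GfamilyI (n : 'I_l -> 'I_k.-1 -> nat) (e : rel (blowup n))
      (e_sym : symmetric e) (e_irr : irreflexive e) of
    admissible pi n &
    (forall x y, e x y -> Gbar_adj x y) &
    (forall x y, Gbar_adj x y -> ~~ e x y ->
       part_of x < (k.-1)`! /\ part_of y < (k.-1)`!) :
  Gfamily l pi (SGraph e_sym e_irr).

Arguments Gfamily {k} l pi _.

(* Main.v *)
Require Import Defs.
From HB Require Import structures.
From mathcomp Require Import all_boot all_order all_fingroup all_algebra.
From mathcomp Require Import reals sequences exp.
From mathcomp Require Import zify.
Set Implicit Arguments.
Unset Strict Implicit.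
Unset Printing Implicit Defensive.
Import Order.TTheory GRing.Theory Num.Theory.

(** Write r = k - 1, m for the common size of the parts and suppose that G has
    no K_r^+(s), where s is about (ln n) / (2 k^((k+6)k)).

    A large U with almost full minimum degree contains K_r(gs) for a large
    constant g, found class by class by averaging and the pigeonhole principle.
    Every vertex has fewer than s neighbours in one of its r classes, and two
    vertices that see most of the r - 1 other classes cannot be adjacent, so
    U is nearly, and by minimum degree even exactly, r-partite.  Choosing U to
    maximise e(U) minus a multiple of |U|^2, this bounds e(U) by Turan's number
    and forces U to be almost everything.  Hence all vertices of G can be
    coloured with r colours such that each has few neighbours of its own colour.

    Let n_i be the vector of colour multiplicities in the part V_i.  Among the
    r! orderings some permutation sorts n_i for at least l / r! of the parts; on
    this cluster Chebyshev's inequality <n_i, n_j> >= m^2 / r and the density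
    hypothesis show that no pair has fewer edges inside colours than non-edges
    between colours.  An edge inside a colour needs an endpoint with many
    non-edges between colours, so neither kind occurs in the cluster, and all
    but one of its parts have constant n_i.  Comparing any other part with these
    shows that the colouring is proper.

    Finally <n_i, n_j> <= m^2 / r for all i <> j, so by the equality case of
    Chebyshev's inequality distinct parts with non-constant n_i are sorted by
    distinct permutations, and a part with constant n_i is completely joined to
    all other colours.  This is the description of the family. *)

(** * Embedding complete multipartite graphs *)

Definition dg (G : sgraph) (v : G) (A : {set G}) := #|[set x in A | adj v x]|.
Definition ndg (G : sgraph) (v : G) (A : {set G}) := #|[set x in A | ~~ adj v x]|.

(** Only sets of index below [p] are constrained, so a family on all of ['I_r] can be filled in one
    class at a time, with arbitrary values from [p] on. *)
Definition complete_upto (G : sgraph) r (p : nat) (A : 'I_r -> {set G}) :=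
  forall i i' : 'I_r, i < p -> i' < p -> i != i' ->
  forall x y, x \in A i -> y \in A i' -> adj x y.

Lemma dg_ndg (G : sgraph) (v : G) A : dg v A + ndg v A = #|A|.
Proof.
rewrite -(cardsID [set x | adj v x] A); congr (_ + _); apply: eq_card => x.
  by rewrite !inE.
by rewrite !inE andbC.
Qed.

Lemma sub_dg (G : sgraph) (v : G) (A B : {set G}) : A \subset B -> dg v A <= dg v B.
Proof.
move=> sAB; apply/subset_leq_card/subsetP => x; rewrite !inE.
by case/andP=> /(subsetP sAB) -> ->.
Qed.

Lemma sub_ndg (G : sgraph) (v : G) (A B : {set G}) : A \subset B -> ndg v A <= ndg v B.
Proof.
move=> sAB; apply/subset_leq_card/subsetP => x; rewrite !inE.
by case/andP=> /(subsetP sAB) -> ->.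
Qed.

Lemma exchange_dg (G : sgraph) (A B : {set G}) :
  \sum_(v in A) dg v B = \sum_(v in B) dg v A.
Proof.
have E (C D : {set G}) : \sum_(v in C) dg v D =
    \sum_(v in C) \sum_(x in D) (adj v x : nat).
  apply: eq_bigr => v _; rewrite /dg -sum1_card big_mkcond [RHS]big_mkcond /=.
  by apply: eq_bigr => x _; rewrite inE; case: (x \in D); case: adj.
rewrite !E exchange_big /=; apply: eq_bigr => v _; apply: eq_bigr => x _.
by rewrite adj_sym.
Qed.

(** The edge [u v] becomes the extra edge. Its ends need not lie in [A j]: putting both in front of
    the rest of [A j] never shrinks that class. Distinct classes are disjoint because adjacency is
    irreflexive. *)
Lemma Kplus_embed (G : sgraph) r s (A : 'I_r -> {set G}) (j : 'I_r) (u v : G) :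
  1 < s -> complete_upto r A -> (forall i, s <= #|A i|) -> adj u v ->
  (forall i x, i != j -> x \in A i -> adj u x && adj v x) ->
  contains_copy G (Kplus r s).
Proof.
move=> s_gt1 cA sA uv cuv.
have r_gt0 : 0 < r by case: r j {A cA sA cuv} => [[]|].
pose j0 := Ordinal r_gt0.
pose L i := if i == j then [:: u, v & enum (A j :\ u :\ v)] else enum (A i).
have neq_uv : u != v by apply: contraTneq uv => ->; rewrite adj_irr.
have uniqL i : uniq (L i).
  rewrite /L; case: eqP => _; last exact: enum_uniq.
  by rewrite /= enum_uniq !inE !mem_enum !inE !eqxx (negPf neq_uv) !andbF.
have sizeL i : s <= size (L i).
  rewrite /L; case: eqP => _; last by rewrite -cardE.
  rewrite /= -cardE; have := sA j.
  by rewrite (cardsD1 u) (cardsD1 v (A j :\ u)); case: (u \in _); case: (v \in _); lia.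
have adjL i i' x y : i != i' -> x \in L i -> y \in L i' -> adj x y.
  move=> ii'; rewrite /L; case: (eqVneq i j) => [ij|nij]; case: (eqVneq i' j) => [i'j|ni'j].
  - by rewrite ij i'j eqxx in ii'.
  - rewrite !inE !mem_enum => /or3P[/eqP->|/eqP->|].
    + by move=> yA; case/andP: (cuv i' y ni'j yA).
    + by move=> yA; case/andP: (cuv i' y ni'j yA).
    + by rewrite !inE => /and3P[_ _ xA] yA; rewrite (cA j i') ?ltn_ord // eq_sym.
  - rewrite !inE !mem_enum => xA /or3P[/eqP->|/eqP->|].
    + by case/andP: (cuv i x nij xA); rewrite adj_sym.
    + by case/andP: (cuv i x nij xA) => _; rewrite adj_sym.
    + by rewrite !inE => /and3P[_ _ yA]; rewrite (cA i j).
  - by rewrite !mem_enum => xA yA; rewrite (cA i i').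
(* [Kplus] has its extra edge in class 0 between positions 0 and 1; the transposition puts [u] and
   [v] there. *)
pose f (x : Kplus r s) := nth u (L (tperm j j0 x.1)) x.2.
have fL x : f x \in L (tperm j j0 x.1) by apply: mem_nth; apply: leq_trans (sizeL _).
have fadj x y : x.1 != y.1 -> adj (f x) (f y).
  by move=> nxy; apply: adjL (fL x) (fL y); rewrite (inj_eq perm_inj).
exists f => [[a b] [a' b'] fE|[a b] [a' b']].
  have aa' : a = a'.
    apply/eqP; apply: contraTT (isT) => naa'.
    by have := fadj (a, b) (a', b') naa'; rewrite fE adj_irr.
  move: fE; rewrite -aa' /f /= => /eqP; rewrite nth_uniq //; last first.
  - exact: leq_trans (sizeL _).
  - exact: leq_trans (sizeL _).
  by move/eqP/val_inj => ->.
case/orP=> [nab|/and3P[/= a0 a'0 bb']]; first exact: fadj.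
have [-> ->] : a = j0 /\ a' = j0 by split; apply/val_inj/eqP.
rewrite /f /= tpermR /L eqxx.
by case/orP: bb' => /andP[/eqP -> /eqP ->] /=; rewrite // adj_sym.
Qed.

(** [v] and one of its neighbours in class 0 form the extra edge, after every class is cut down to
    the neighbourhood of [v]. *)
Lemma Kplus_embed_vertex (G : sgraph) r s (A : 'I_r -> {set G}) (v : G) :
  0 < r -> 1 < s -> complete_upto r A -> (forall i, s <= dg v (A i)) ->
  contains_copy G (Kplus r s).
Proof.
move=> r_gt0 s_gt1 cA sA; pose j := Ordinal r_gt0.
have /card_gt0P[u] : 0 < dg v (A j) by apply: leq_trans (sA j); lia.
rewrite inE => /andP[uA vu].
apply: (@Kplus_embed _ _ _ (fun i => [set x in A i | adj v x]) j u v) => //.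
- move=> i i' ip i'p ii' x y; rewrite !inE => /andP[xA _] /andP[yA _].
  exact: (cA i i').
- by rewrite adj_sym.
- move=> i x ij; rewrite inE => /andP[xA ->]; rewrite andbT.
  by rewrite (cA j i) // eq_sym.
Qed.

Lemma subset_of_size (T : finType) (A : {set T}) k :
  k <= #|A| -> exists2 B : {set T}, B \subset A & #|B| = k.
Proof.
move=> kA; have : size (take k (enum A)) = k by rewrite size_takel // -cardE.
have := take_uniq k (enum_uniq A) => uB sB.
exists [set x in take k (enum A)]; last by rewrite cardsE (card_uniqP uB).
by apply/subsetP => x; rewrite inE => /mem_take; rewrite mem_enum.
Qed.

Lemma pigeonhole_fibre (T U : finType) (f : T -> U) (S : {set T}) (D : {set U}) t :
  (forall x, x \in S -> f x \in D) -> 0 < t -> t * #|D| <= #|S| -> 0 < #|S| ->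
  exists2 y, y \in D & t <= #|[set x in S | f x == y]|.
Proof.
move=> fD t_gt0 tD S_gt0; case: (boolP [exists y in D, t <= #|[set x in S | f x == y]|]).
  by case/exists_inP=> y; exists y.
rewrite negb_exists_in => /forall_inP small; exfalso.
have D_gt0 : 0 < #|D|.
  by case/card_gt0P: S_gt0 => x /fD ?; apply/card_gt0P; exists (f x).
suff : #|S| <= (t.-1) * #|D| by rewrite -subn1 mulnBl mul1n; nia.
rewrite -sum1_card (partition_big f (mem D)) //= mulnC -sum_nat_const.
apply: leq_sum => y yD; have := small y yD; rewrite -ltnNge => lt_t.
by rewrite sum1dep_card -ltnS prednK.
Qed.

(* Vertices with many neighbours in the p sets found so far have at most
   2^(r t_0) distinct traces on them, hence many share one trace. *)
Lemma embed_complete (G : sgraph) r (C : 'I_r -> {set G}) (t : nat -> nat) M :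
  (forall p, t p.+1 <= t p) -> 0 < t r -> t 0 * 2 ^ (r * t 0) <= M ->
  (forall (p : 'I_r) (A : 'I_r -> {set G}),
     (forall i : 'I_r, i < p -> A i \subset C i /\ #|A i| = t p) ->
     complete_upto p A ->
     M <= #|[set v in C p | [forall i : 'I_r, (i < p) ==> (t p.+1 <= dg v (A i))]]|) ->
  exists A : 'I_r -> {set G},
    (forall i, A i \subset C i /\ #|A i| = t r) /\ complete_upto r A.
Proof.
move=> t_dec tr_gt0 t0M step.
have t_anti p q : p <= q -> t q <= t p.
  by move/subnK<-; elim: (q - p) => //= d; apply: leq_trans (t_dec _).
suff main p : p <= r -> exists A : 'I_r -> {set G},
    (forall i : 'I_r, i < p -> A i \subset C i /\ #|A i| = t p) /\ complete_upto p A.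
  have [A [sA cA]] := main r (leqnn r).
  by exists A; split => // i; exact: sA.
elim: p => [_|p IH pr]; first by exists (fun=> set0); split=> [//|i i'].
have [A [sA cA]] := IH (ltnW pr); pose q := Ordinal pr.
have := step q A sA cA; set S := finset _ => MS.
pose B := \bigcup_(i : 'I_r | i < p) A i.
have cardB : #|B| <= r * t 0.
  apply: leq_trans (_ : \sum_(i : 'I_r | i < p) #|A i| <= _).
    rewrite /B; elim/big_rec2: _ => [|i m X _ le]; first by rewrite cards0.
    apply: leq_trans (leq_add (leqnn _) le).
    by rewrite cardsU leq_subr.
  rewrite -[r in leqRHS]card_ord -sum_nat_const [leqRHS]big_mkcond /= [leqLHS]big_mkcond.
  apply: leq_sum => i _; case: ifP => // ip; case: (sA i ip) => _ ->.
  exact: t_anti.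
have t0_gt0 : 0 < t 0 by apply: leq_trans tr_gt0 (t_anti _ _ _).
have M_gt0 : 0 < M by apply: leq_trans t0M; rewrite muln_gt0 t0_gt0 expn_gt0.
have [||||P PB] := @pigeonhole_fibre _ _ (fun v => [set x in B | adj v x]) S (powerset B) (t 0).
- by move=> v _; rewrite inE; apply/subsetP => x; rewrite inE => /andP[].
- exact: t0_gt0.
- rewrite card_powerset; apply: leq_trans MS; apply: leq_trans t0M.
  by rewrite leq_mul2l leq_pexp2l // orbT.
- exact: leq_trans MS.
set F := finset _ => sF.
have [T sTF cT] : exists2 T : {set G}, T \subset F & #|T| = t p.+1.
  by apply: subset_of_size; apply: leq_trans sF; apply: t_anti.
(* Members of [F] share the trace [P], so a subset of [A i] inside [P] is joined to all of [F].
   Indices not below [p] get a dummy set. *)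
have sub (i : 'I_r) : exists D : {set G}, (i < p) ==>
    [&& D \subset A i, D \subset P & #|D| == t p.+1].
  case: (boolP (i < p)) => ip; last by exists set0.
  have /card_gt0P[v vF] : 0 < #|F| by apply: leq_trans sF; apply: t0_gt0.
  move: vF; rewrite !inE => /andP[/andP[_ /forallP/(_ i)]].
  rewrite ip /= => le /eqP PE.
  have [D sD cD] := subset_of_size le; exists D; rewrite cD eqxx andbT /=; apply/andP; split.
    by apply/subsetP => x /(subsetP sD); rewrite inE => /andP[].
  apply/subsetP => x /(subsetP sD); rewrite -PE !inE => /andP[xA ->].
  by rewrite andbT; apply/bigcupP; exists i.
pose D i := xchoose (sub i).
have DP (i : 'I_r) : i < p -> [/\ D i \subset A i, D i \subset P & #|D i| = t p.+1].
  by move=> ip; have /implyP/(_ ip)/and3P[? ? /eqP] := xchooseP (sub i).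
pose A' (i : 'I_r) := if i < p then D i else T.
have adjT (i : 'I_r) x y : i < p -> x \in D i -> y \in T -> adj x y.
  move=> ip /(subsetP (let: And3 _ h _ := DP i ip in h)) xP /(subsetP sTF).
  rewrite !inE => /andP[_ /eqP E]; move: xP; rewrite -E inE => /andP[_].
  by rewrite adj_sym.
exists A'; split=> [i|i i'].
  rewrite ltnS /A' => ip; case: ifP => [i_p|ni_p].
    have [h _ ->] := DP i i_p; split=> //; apply: subset_trans h _.
    by case: (sA i i_p).
  have -> : i = q by apply: val_inj => /=; lia.
  split=> //; apply: subset_trans sTF _; apply/subsetP => x.
  by rewrite !inE => /andP[/andP[]].
rewrite !ltnS /A' => ip i'p ii' x y.
case: ifP => i_p; case: ifP => i'_p.
- have [h _ _] := DP i i_p; have [h' _ _] := DP i' i'_p.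
  by move=> /(subsetP h) xA /(subsetP h') yA; apply: (cA i i').
- exact: adjT.
- by move=> xT yD; rewrite adj_sym; apply: adjT i'_p yD xT.
- by case/negP: ii'; apply/eqP/val_inj => /=; lia.
Qed.

(** A vertex of [U] outside [S] falls short of the trivial degree bound by at least [T - T'] in some
    class. A large degree sum therefore leaves few such vertices. *)
Lemma sum_dg_deficit (G : sgraph) (I : finType) (D : pred I) (A : I -> {set G})
    (U S : {set G}) T T' :
  S \subset U -> (forall i, D i -> #|A i| = T) -> T' <= T ->
  (forall v, v \in U -> v \notin S -> exists2 i, D i & dg v (A i) <= T') ->
  \sum_(v in U) \sum_(i | D i) dg v (A i) + #|U :\: S| * (T - T') <=
    #|U| * (#|[pred i | D i]| * T).
Proof.
move=> sSU cA TT' fail.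
rewrite -!sum_nat_const (big_setID S) /= (setIidPr sSU) [leqRHS](big_setID S) /=.
rewrite (setIidPr sSU) -addnA -big_split /= leq_add //; apply: leq_sum => v.
  by move=> _; apply: leq_sum => i Di; rewrite -(cA i Di) -(dg_ndg v) leq_addr.
rewrite inE => /andP[vS vU]; have [i Di le] := fail v vU vS.
rewrite (bigD1 i) //= [leqRHS](bigD1 i) //= addnAC leq_add //; first lia.
by apply: leq_sum => i' /andP[Di' _]; rewrite -(cA i' Di') -(dg_ndg v) leq_addr.
Qed.

Lemma card_ord_lt r (p : 'I_r) : #|[pred i : 'I_r | i < p]| < r.
Proof.
rewrite -[ltnRHS]card_ord -cardsT; apply: proper_card; apply/properP.
by split; [apply/subsetP | exists p; rewrite !inE // ltnn].
Qed.

(** Of [u] vertices, [y] have at least [x] neighbours in each of [c] given sets of size [4 * r * x];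
    [Sg] counts the adjacent pairs between the vertices and these sets. A fixed proportion of the
    vertices qualifies. *)
Lemma dense_complete_arith r c x u y Sg :
  0 < x -> y <= u -> c < r ->
  Sg + (u - y) * (4 * r * x - x) <= u * (c * (4 * r * x)) ->
  c * (4 * r * x * ((4 * r ^ 2 - 4 * r - 1) * u)) <= 4 * r ^ 2 * Sg ->
  u <= 2 * r ^ 2 * y.
Proof.
move=> x_gt0 yu; case: r => // q c_le le1 le2.
set r := q.+1 in le1 le2 *; set a := _ - _ in le2.
have a_ge : 4 * r ^ 2 <= a + 4 * r + 1 by rewrite /a; lia.
have dE : 4 * r * x - x = (4 * q + 3) * x by rewrite /r; nia.
move: le1; rewrite dE; set d := u - y => le1.
have uE : u = y + d by rewrite /d subnKC.
have step1 : c * a * u + r * d * (4 * q + 3) <= 4 * r ^ 2 * u * c.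
  have pos : 0 < 4 * r * x by rewrite !muln_gt0.
  rewrite -(leq_pmul2l pos); have := leq_mul (leqnn (4 * r ^ 2)) le1; lia.
have step2 : r * (4 * q + 3) * d <= (4 * r + 1) * q * u.
  have : c * u * (4 * r ^ 2) <= c * u * (a + 4 * r + 1) by rewrite leq_mul2l a_ge orbT.
  have : c * (u * (4 * r + 1)) <= q * (u * (4 * r + 1)) by rewrite leq_mul2r -ltnS c_le orbT.
  lia.
move: step2; rewrite /r uE; clear; nia.
Qed.

Lemma near_complete_arith r c x w y z mu M Sg :
  0 < x -> y <= w -> c < r -> z <= w -> 2 * M <= z -> 4 * r * mu <= z ->
  Sg + (w - y) * (2 * x - x) <= w * (c * (2 * x)) ->
  c * (2 * x * w) <= Sg + c * (2 * x * mu) ->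
  M <= y.
Proof.
move=> x_gt0 yw c_lt zw Mz muz le1 le2.
have step : w - y <= c * (2 * mu) by rewrite -(leq_pmul2r x_gt0); nia.
have : c * (2 * mu) <= r * (2 * mu) by rewrite leq_mul2r ltnW ?orbT.
lia.
Qed.

(** All degrees are at least [1 - 1/r - 1/(4 r^2)] times [|U|], above the threshold [1 - 1/(r-1)]
    for an r-clique. The class size shrinks by the factor [4 * r] at each of the [r] extensions. *)
Lemma dense_complete (G : sgraph) r t (U : {set G}) :
  0 < r -> 0 < t ->
  (forall v, v \in U -> (4 * r ^ 2 - 4 * r - 1) * #|U| <= 4 * r ^ 2 * dg v U) ->
  2 * r ^ 2 * (((4 * r) ^ r * t) * 2 ^ (r * ((4 * r) ^ r * t))) <= #|U| ->
  exists A : 'I_r -> {set G},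
    (forall i, A i \subset U /\ #|A i| = t) /\ complete_upto r A.
Proof.
move=> r_gt0 t_gt0 degU sU.
pose tt p := (4 * r) ^ (r - p) * t.
have [|||p A sA cA|A [sA cA]] := @embed_complete G r (fun=> U) tt (tt 0 * 2 ^ (r * tt 0)).
- by move=> p; rewrite /tt leq_mul2r leq_pexp2l ?orbT ?muln_gt0 // leq_sub2l.
- by rewrite /tt subnn expn0 mul1n.
- by [].
- set S := finset _; have sSU : S \subset U by apply/subsetP => v; rewrite inE => /andP[].
  have tp : tt p = 4 * r * tt p.+1.
    by rewrite /tt -(subnSK (ltn_ord p)) expnS mulnA.
  have tp1_gt0 : 0 < tt p.+1 by rewrite /tt muln_gt0 t_gt0 expn_gt0 muln_gt0 r_gt0.
  have h1 (i : 'I_r) : i < p -> #|A i| = tt p by move/sA => [].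
  have h2 : tt p.+1 <= tt p by rewrite tp leq_pmull // muln_gt0.
  have h3 v : v \in U -> v \notin S -> exists2 i : 'I_r, i < p & dg v (A i) <= tt p.+1.
    move=> vU; rewrite inE vU /= => /forallPn[i].
    by rewrite negb_imply -ltnNge => /andP[ip /ltnW]; exists i.
  have := sum_dg_deficit sSU h1 h2 h3.
  rewrite exchange_big /=; set c := #|[pred i : 'I_r | _]|.
  have := card_ord_lt p; rewrite -/c => c_lt.
  set Sg := \sum_(i < r | _) _ => le1.
  have le2 : c * (tt p * ((4 * r ^ 2 - 4 * r - 1) * #|U|)) <= 4 * r ^ 2 * Sg.
    rewrite big_distrr /= -sum_nat_const; apply: leq_sum => i ip.
    rewrite exchange_dg big_distrr /=; have [sAU <-] := sA i ip.
    by rewrite -sum_nat_const; apply: leq_sum => x /(subsetP sAU); apply: degU.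
  have cUS : #|U :\: S| = #|U| - #|S| by rewrite cardsDS.
  have SU : #|S| <= #|U| by apply: subset_leq_card.
  move: le1 le2; rewrite cUS tp.
  set x := tt p.+1; set u := #|U|; set y := #|S|; rewrite -/x in tp1_gt0.
  rewrite -/u -/y in SU => le1 le2.
  have key : u <= 2 * r ^ 2 * y.
    exact: dense_complete_arith tp1_gt0 SU c_lt le1 le2.
  have : 2 * r ^ 2 * (tt 0 * 2 ^ (r * tt 0)) <= 2 * r ^ 2 * y.
    by apply: leq_trans key; rewrite /tt subn0.
  by rewrite leq_pmul2l // muln_gt0 expn_gt0 r_gt0.
by exists A; split=> // i; have := sA i; rewrite /tt subnn expn0 mul1n.
Qed.

(** Every class other than [B j] is restricted to the common neighbours of [u] and [v]. The classes
    are almost completely joined, so shrinking by the factor 2 per extension suffices. Neither [u]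
    nor [v] has to belong to a class. *)
Lemma near_complete_Kplus (G : sgraph) r s mu z (B : 'I_r -> {set G}) j (u v : G) :
  1 < s ->
  (forall i i' x, i != i' -> x \in B i -> ndg x (B i') <= mu) ->
  adj u v -> z <= #|B j| ->
  (forall i, i != j -> z <= #|[set x in B i | adj u x && adj v x]|) ->
  4 * r * mu <= z ->
  2 * ((2 ^ r * s) * 2 ^ (r * (2 ^ r * s))) <= z ->
  contains_copy G (Kplus r s).
Proof.
move=> s_gt1 miss uv zBj zB muz tz.
pose C i := if i == j then B j else [set x in B i | adj u x && adj v x].
have zC i : z <= #|C i| by rewrite /C; case: ifP => // /negbT /zB.
have sCB i : C i \subset B i.
  rewrite /C; case: eqP => [->//|_]; apply/subsetP => x.
  by rewrite inE => /andP[].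
pose tt p := 2 ^ (r - p) * s.
have [|||p A sA cA|A [sA cA]] := @embed_complete G r C tt (tt 0 * 2 ^ (r * tt 0)).
- by move=> p; rewrite /tt leq_mul2r leq_pexp2l ?orbT ?muln_gt0 // leq_sub2l.
- by rewrite /tt subnn expn0 mul1n (ltnW s_gt1).
- by [].
- set S := finset _; have sSU : S \subset C p by apply/subsetP => v0; rewrite inE => /andP[].
  have tp : tt p = 2 * tt p.+1.
    by rewrite /tt -(subnSK (ltn_ord p)) expnS mulnA.
  have tp1_gt0 : 0 < tt p.+1 by rewrite /tt muln_gt0 expn_gt0 (ltnW s_gt1).
  have h1 (i : 'I_r) : i < p -> #|A i| = tt p by move/sA => [].
  have h2 : tt p.+1 <= tt p by rewrite tp leq_pmull.
  have h3 w : w \in C p -> w \notin S -> exists2 i : 'I_r, i < p & dg w (A i) <= tt p.+1.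
    move=> wC; rewrite inE wC /= => /forallPn[i].
    by rewrite negb_imply -ltnNge => /andP[ip /ltnW]; exists i.
  have := sum_dg_deficit sSU h1 h2 h3.
  rewrite exchange_big /=; set c := #|[pred i : 'I_r | _]|.
  have := card_ord_lt p; rewrite -/c => c_lt.
  set Sg := \sum_(i < r | _) _ => le1.
  have le2 : c * (tt p * #|C p|) <= Sg + c * (tt p * mu).
    rewrite -!sum_nat_const -big_split /=; apply: leq_sum => i ip.
    rewrite exchange_dg; have [sAC <-] := sA i ip.
    rewrite -!sum_nat_const -big_split /=; apply: leq_sum => x /(subsetP sAC) xC.
    rewrite -(dg_ndg x (C p)) leq_add2l; apply: leq_trans (sub_ndg x (sCB p)) _.
    by apply: (miss i); [rewrite -val_eqE /= neq_ltn (ip : i < p) | exact: (subsetP (sCB i))].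
  have cUS : #|C p :\: S| = #|C p| - #|S| by rewrite cardsDS.
  have SU : #|S| <= #|C p| by apply: subset_leq_card.
  move: le1 le2; rewrite cUS tp.
  have tz' : 2 * (tt 0 * 2 ^ (r * tt 0)) <= z by rewrite /tt subn0.
  move: tz'; move: (zC p); set M := tt 0 * _.
  set x := tt p.+1; set w := #|C p|; set y := #|S|; rewrite -/x in tp1_gt0.
  rewrite -/w -/y in SU => zw Mz le1 le2.
  exact: near_complete_arith tp1_gt0 SU c_lt zw Mz muz le1 le2.
apply: (@Kplus_embed _ _ _ A j u v) => //.
  by move=> i; case: (sA i) => _ ->; rewrite /tt subnn expn0 mul1n.
move=> i x ij /(subsetP (proj1 (sA i))); rewrite /C (negPf ij) inE.
by case/andP.
Qed.

(** * Structure of near-extremal graphs *)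

Lemma card_ord_neq r (j : 'I_r) : #|[pred i | i != j]| = r - 1.
Proof. by rewrite subn1 -[r in RHS]card_ord -(cardC1 j); apply: eq_card. Qed.

Lemma card_bigcup_le (I T : finType) (P : pred I) (B : I -> {set T}) :
  #|\bigcup_(i | P i) B i| <= \sum_(i | P i) #|B i|.
Proof.
elim/big_rec2: _ => [|i m X _ le]; first by rewrite cards0.
by apply: leq_trans (leq_add (leqnn _) le); rewrite cardsU leq_subr.
Qed.

Lemma card_common (G : sgraph) (u v : G) (A : {set G}) :
  dg u A + dg v A <= #|A| + #|[set x in A | adj u x && adj v x]|.
Proof.
rewrite /dg -cardsUI leq_add //.
  by apply/subset_leq_card/subsetP => x; rewrite !inE; case: (x \in A).
by apply: eq_leq; apply: eq_card => x; rewrite !inE; case: (x \in A).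
Qed.

Lemma trace_arith_dense r g d u :
  1 < r -> 4 * r <= g -> (r * g - g - 1) * u <= r * g * d ->
  (4 * r ^ 2 - 4 * r - 1) * u <= 4 * r ^ 2 * d.
Proof.
move=> r_gt1 rg le; have g_gt0 : 0 < g by lia.
rewrite -(leq_pmul2l g_gt0).
have : 4 * r * ((r * g - g - 1) * u) <= 4 * r * (r * g * d) by rewrite leq_mul2l le orbT.
have : g * (4 * r ^ 2 - 4 * r - 1) <= 4 * r * (r * g - g - 1).
  case: r r_gt1 rg {le} => [|[|q]] // _ rg.
  have -> : 4 * q.+2 ^ 2 - 4 * q.+2 - 1 = 4 * q ^ 2 + 12 * q + 7 by lia.
  have -> : q.+2 * g - g - 1 = q * g + (g - 1) by lia.
  nia.
move=> le1 le2; apply: leq_trans (_ : 4 * r * ((r * g - g - 1) * u) <= _); last lia.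
by rewrite mulnA [leqRHS]mulnA leq_mul2r le1 orbT.
Qed.

(** [w] counts the vertices left out of the classes: such a vertex has fewer than [s] neighbours in
    one set of size [g * s] and fewer than about half of another, while the minimum degree makes the
    average loss beyond the first set small. *)
Lemma trace_arith_rest r g s u w Sg :
  1 < r -> 4 * r <= g -> 0 < s -> w <= u ->
  g * s * ((r * g - g - 1) * u) <= g * Sg ->
  2 * Sg + w * (g * s) <= u * (2 * ((r - 1) * (g * s)) + 2 * s) + w * s ->
  g * w <= 5 * u.
Proof.
move=> r_gt1 rg s_gt0 wu le1 le2.
have g_gt0 : 0 < g by lia.
have rgE : r * g - g - 1 = (r - 2) * g + (g - 1) by case: r r_gt1 {le1 le2 rg} => [|[|q]] // _; lia.
have r1E : r - 1 = (r - 2) + 1 by lia.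
move: le1 le2; rewrite rgE r1E; set q := r - 2; clear r1E rgE => le1 le2.
have gE : g = (g - 1) + 1 by lia.
move: le1 le2; rewrite gE; set h := g - 1; rewrite addnK => le1 le2.
have : (h + 1) * s * (h * w) <= (h + 1) * s * (4 * u).
  have := leq_mul (leqnn (h + 1)) le2; nia.
rewrite leq_pmul2l ?muln_gt0 ?addn1 //; nia.
Qed.

Lemma nonneighbour_arith r g a b :
  1 < r -> (r * g - g - 1) * (a + b) <= r * g * a -> r * g * b <= (g + 1) * (a + b).
Proof.
case: r => [|[|q]] // _; case: g => [|g]; first by move=> _; rewrite muln0 mul0n.
have -> : q.+2 * g.+1 - g.+1 - 1 = q * g + q + g by lia.
nia.
Qed.

Lemma class_size_arith r g u w a b :
  1 < r -> 6 * r <= g -> u <= w + (a + b) ->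
  r * g * b <= (r - 1) * ((g + 1) * u) -> g * w <= 5 * u ->
  (g - 6 * r) * u <= r * g * a.
Proof.
move=> r_gt1 g6 le le2 le3.
have le4 : r * g * u <= r * (5 * u) + r * g * a + (r - 1) * ((g + 1) * u).
  have : r * g * u <= r * g * (w + (a + b)) by rewrite leq_mul2l le orbT.
  have : r * (g * w) <= r * (5 * u) by rewrite leq_mul2l le3 orbT.
  move: le2; clear; move: (_ * (_ * u)) => X; lia.
have [h gE] : exists h, g = h + 6 * r by exists (g - 6 * r); lia.
subst g; rewrite addnK; move: le4; case: r r_gt1 {g6 le le2 le3} => [//|q] _.
rewrite subn1 /=; nia.
Qed.

Lemma class_miss_arith r g u a b :
  0 < r -> (g - 6 * r) * u <= r * g * a -> r * g * (a + b) <= (g + 1) * u ->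
  g * b <= 7 * u.
Proof.
move=> r_gt0 le1 le2; rewrite -(leq_pmul2l r_gt0).
have : g * u <= (g - 6 * r) * u + 6 * r * u by rewrite -mulnDl leq_mul2r; lia.
nia.
Qed.

(* The classes B j collect the vertices of U with almost no neighbours in the
   j-th class of a K_r(gs) and more than half of every other class. *)
Lemma trace_classes (G : sgraph) r s g (U : {set G}) :
  1 < r -> 1 < s -> 151 * r ^ 2 <= g ->
  (forall v, v \in U -> (r * g - g - 1) * #|U| <= r * g * dg v U) ->
  g * (((4 * r) ^ r * (g * s)) * 2 ^ (r * ((4 * r) ^ r * (g * s)))) <= #|U| ->
  ~ contains_copy G (Kplus r s) ->
  exists B : 'I_r -> {set G},
    [/\ forall j, B j \subset U,
        forall i i' x, i != i' -> x \in B i -> x \notin B i',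
        g * #|U :\: \bigcup_j B j| <= 5 * #|U|,
        forall j, (g - 6 * r) * #|U| <= r * g * #|B j| &
        forall i i' x, i != i' -> x \in B i -> g * ndg x (B i') <= 7 * #|U|].
Proof.
move=> r_gt1 s_gt1 rg degU sU noK.
have rg4 : 4 * r <= g by nia.
have [|||A [sA cA]] := @dense_complete G r (g * s) U (ltnW r_gt1).
- by rewrite muln_gt0; lia.
- by move=> v /degU; apply: trace_arith_dense.
- apply: leq_trans sU; rewrite leq_mul2r; apply/orP; right; nia.
have low v : exists j, dg v (A j) < s.
  apply/existsP; apply: contra_notT noK; rewrite negb_exists => /forallP h.
  by apply: (Kplus_embed_vertex (ltnW r_gt1) s_gt1 cA) => i; rewrite leqNgt.
pose B j := [set v in U | (dg v (A j) < s) &&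
  [forall i, (i != j) ==> (g * s + s <= 2 * dg v (A i))]].
have sBU j : B j \subset U by apply/subsetP => v; rewrite inE => /andP[].
have indep j x y : x \in B j -> y \in B j -> ~~ adj x y.
  rewrite !inE => /and3P[_ _ /forallP hx] /and3P[_ _ /forallP hy].
  apply/negP => xy; apply: noK.
  (* For [i != j] both [x] and [y] see at least [(g s + s) / 2] of the [g s] vertices of [A i],
     hence at least [s] in common. *)
  pose A' i := if i == j then A j else [set z in A i | adj x z && adj y z].
  have sA' i : A' i \subset A i.
    by rewrite /A'; case: eqP => [->//|_]; apply/subsetP => z; rewrite inE => /andP[].
  apply: (@Kplus_embed _ _ _ A' j x y) => //.
  - move=> i i' ip i'p ii' a b /(subsetP (sA' i)) aA /(subsetP (sA' i')).
    exact: (cA i i').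
  - move=> i; rewrite /A'; case: (eqVneq i j) => [ij|ij].
      by rewrite (proj2 (sA j)); nia.
    have := card_common x y (A i); rewrite (proj2 (sA i)).
    have := implyP (hx i) ij; have := implyP (hy i) ij; lia.
  - by move=> i z ij; rewrite /A' (negPf ij) inE => /andP[].
have disj i i' x : i != i' -> x \in B i -> x \notin B i'.
  move=> ii'; rewrite !inE => /and3P[-> lt /forallP/(_ i')].
  rewrite eq_sym ii' /= => le; rewrite negb_and -leqNgt.
  by apply/orP; left; nia.
set W := U :\: \bigcup_j B j.
have sWU : W \subset U by apply: subsetDl.
have WB : g * #|W| <= 5 * #|U|.
  pose Sg := \sum_(v in U) \sum_i dg v (A i).
  apply: (@trace_arith_rest r g s _ _ Sg) => //; first lia.
  - exact: subset_leq_card.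
  - have r_gt0 : 0 < r by lia.
    rewrite -(leq_pmul2l r_gt0) [leqRHS]mulnA /Sg exchange_big /= big_distrr /=.
    rewrite -[X in X * _ <= _](card_ord r) -sum_nat_const; apply: leq_sum => i _.
    have [sAU <-] := sA i; rewrite exchange_dg big_distrr /= -sum_nat_const.
    by apply: leq_sum => x /(subsetP sAU); apply: degU.
  - rewrite -!sum_nat_const /Sg (big_setID W) [X in _ <= X + _](big_setID W) /=.
    rewrite (setIidPr sWU) mulnDr addnAC [leqRHS]addnAC leq_add //.
      rewrite big_distrr -!big_split /=; apply: leq_sum => v.
      rewrite inE => /andP[vB vU]; have [j vj] := low v.
      have : v \notin B j.
        by apply: contra vB => vB; apply/bigcupP; exists j.
      rewrite inE vU vj /= => /forallPn[i]; rewrite negb_imply -ltnNge => /andP[ij vi].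
      rewrite (bigD1 j) //= (bigD1 i) //=.
      set Sm := \sum_(k | _) _.
      have : Sm <= (r - 2) * (g * s).
        have -> : r - 2 = #|[pred i0 | (i0 != j) && (i0 != i)]|.
          have := cardC (pred2 j i); rewrite card2 eq_sym ij card_ord.
          move=> h; rewrite -[in LHS]h addKn; apply: eq_card => k.
          by rewrite !inE negb_or.
        rewrite -sum_nat_const; apply: leq_sum => k _.
        by rewrite -(proj2 (sA k)) -(dg_ndg v) leq_addr.
      have -> : r - 1 = (r - 2) + 1 by lia.
      by move: vj vi; clear; rewrite mulnDl; lia.
    rewrite big_distrr /=; apply: leq_sum => v _; have [j vj] := low v.
    rewrite (bigD1 j) //=.
    set Sm := \sum_(k | _) _.
    have : Sm <= (r - 1) * (g * s).
      rewrite -(card_ord_neq j) -sum_nat_const; apply: leq_sum => k _.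
      by rewrite -(proj2 (sA k)) -(dg_ndg v) leq_addr.
    by move: vj; clear; lia.
have ndgU x : x \in U -> r * g * ndg x U <= (g + 1) * #|U|.
  move=> /degU; rewrite -(dg_ndg x U); set a := dg _ _; set b := ndg _ _.
  exact: nonneighbour_arith.
(* Independence bounds [B j] by the number of non-neighbours of any one of its members. *)
have upB j : r * g * #|B j| <= (g + 1) * #|U|.
  case: (set_0Vmem (B j)) => [->|[x xB]]; first by rewrite cards0 muln0.
  apply: leq_trans (ndgU x (subsetP (sBU j) x xB)); rewrite leq_mul2l; apply/orP; right.
  apply/subset_leq_card/subsetP => y yB; rewrite inE (subsetP (sBU j)) //=.
  exact: indep xB yB.
have lowB j : (g - 6 * r) * #|U| <= r * g * #|B j|.
  have : #|U| <= #|W| + \sum_i #|B i|.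
    rewrite -(cardsID (\bigcup_j B j) U) addnC leq_add2l.
    apply: leq_trans (card_bigcup_le _ _); apply: subset_leq_card; exact: subsetIr.
  rewrite (bigD1 j) //= => le.
  have le2 : r * g * (\sum_(i | i != j) #|B i|) <= (r - 1) * ((g + 1) * #|U|).
    by rewrite -(card_ord_neq j) -sum_nat_const big_distrr /=; apply: leq_sum.
  by apply: (class_size_arith r_gt1 _ le le2 WB); lia.
exists B; split=> // i i' x ii' xB.
have xU := subsetP (sBU i) x xB.
(* [x] misses its whole class, about [|U| / r] vertices, which nearly exhausts the non-neighbours
   that the minimum degree allows. *)
have le : #|B i| + ndg x (B i') <= ndg x U.
  rewrite /ndg -cardsUI; set I := _ :&: _.
  have -> : I = set0.
    apply/setP => y; rewrite !inE; apply/negP => /andP[h /andP[h' _]].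
    have yB : y \in B i by rewrite inE.
    by have := disj i i' y ii' yB; rewrite inE h'.
  rewrite cards0 addn0; apply/subset_leq_card/subsetP => y.
  case/setUP => [yB|]; first by rewrite inE (subsetP (sBU i)) //= (indep i).
  by rewrite !inE => /andP[/andP[-> _] ->].
have le1 := lowB i; have le2 := ndgU x xU.
apply: (class_miss_arith _ le1); first lia.
by apply: leq_trans le2; rewrite leq_mul2l le orbT.
Qed.

(** Doubling turns both sides into sums over all pairs [(i, j)], whose terms differ by
    [(a i - a j) (b i - b j)], nonnegative for similarly ordered sequences. Recording equality
    termwise gives the rigidity used later. *)
Lemma chebyshev_leqif r (a b : 'I_r -> nat) :
  (forall i j, (a i <= a j) && (b i <= b j) || (a j <= a i) && (b j <= b i)) ->
  2 * ((\sum_i a i) * (\sum_i b i)) <= 2 * (r * \sum_i a i * b i)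
    ?= iff [forall i, forall j, a i * b j + a j * b i == a i * b i + a j * b j].
Proof.
move=> ab.
have -> : 2 * ((\sum_i a i) * (\sum_i b i)) =
    \sum_i \sum_j (a i * b j + a j * b i).
  under [RHS]eq_bigr do rewrite big_split /=.
  rewrite big_split /= [X in _ = _ + X]exchange_big /= addnn -mul2n.
  by rewrite big_distrlr.
have -> : 2 * (r * \sum_i a i * b i) =
    \sum_i \sum_j (a i * b i + a j * b j).
  under [RHS]eq_bigr do rewrite big_split /= sum_nat_const card_ord.
  by rewrite big_split /= sum_nat_const card_ord -big_distrr /= addnn -mul2n.
apply: leqif_sum => i _; apply: leqif_sum => j _.
by split=> //; case/orP: (ab i j) => /andP[]; nia.
Qed.

Lemma chebyshev_sum r (a b : 'I_r -> nat) :
  (forall i j, (a i <= a j) && (b i <= b j) || (a j <= a i) && (b j <= b i)) ->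
  (\sum_i a i) * (\sum_i b i) <= r * \sum_i a i * b i.
Proof. by move/chebyshev_leqif => [le _]; rewrite leq_pmul2l in le. Qed.

Lemma chebyshev_eq r (a b : 'I_r -> nat) :
  (forall i j, (a i <= a j) && (b i <= b j) || (a j <= a i) && (b j <= b i)) ->
  r * (\sum_i a i * b i) <= (\sum_i a i) * (\sum_i b i) ->
  forall i j, a i * b j + a j * b i = a i * b i + a j * b j.
Proof.
move=> ab le i j; have [le' E] := chebyshev_leqif ab.
have : 2 * ((\sum_i a i) * (\sum_i b i)) == 2 * (r * \sum_i a i * b i).
  by rewrite eqn_leq le' leq_pmul2l.
by rewrite E => /forallP/(_ i)/forallP/(_ j)/eqP.
Qed.

(** Each vertex misses its own colour class, so the ordered non-adjacent pairs number at least the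
    sum of the squared class sizes, which Chebyshev's inequality with [a = b] bounds below by
    [|U|^2 / r]. *)
Lemma turan_coloring (G : sgraph) r (U : {set G}) (c : G -> 'I_r) :
  (forall x y, x \in U -> y \in U -> c x = c y -> ~~ adj x y) ->
  r * (\sum_(v in U) dg v U) <= (r - 1) * #|U| ^ 2.
Proof.
move=> col; pose a (j : 'I_r) := #|[set x in U | c x == j]|.
have sa : \sum_j a j = #|U|.
  rewrite -sum1_card (partition_big c predT) //=; apply: eq_bigr => j _.
  by rewrite sum1dep_card.
have up : \sum_(v in U) dg v U + \sum_j a j * a j <= #|U| ^ 2.
  have -> : \sum_j a j * a j = \sum_(v in U) a (c v).
    rewrite (partition_big c predT) //=; apply: eq_bigr => j _.
    rewrite (eq_bigr (fun=> a j)); last by move=> v /andP[_ /eqP->].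
    by rewrite sum_nat_cond_const /a cardsE.
  rewrite -big_split /= expnS expn1 -sum_nat_const; apply: leq_sum => v vU.
  rewrite -[leqRHS](dg_ndg v) leq_add2l; apply/subset_leq_card/subsetP => y.
  by rewrite !inE => /andP[yU /eqP cy]; rewrite yU col.
have cs : #|U| * #|U| <= r * \sum_j a j * a j.
  by rewrite -sa; apply: chebyshev_sum => i j; rewrite !andbb leq_total.
have := leq_mul (leqnn r) up; move: cs; clear -r.
move: (\sum_j _) (\sum_(v in U) _) #|U| => X Y u cs le.
have : r <= r - 1 + 1 by lia.
move: (r - 1) => q rq; have := leq_mul rq (leqnn (u ^ 2)); nia.
Qed.

Lemma near_classes_Kplus (G : sgraph) r s g n (B : 'I_r -> {set G}) j (u v : G) :
  1 < r -> 1 < s -> 151 * r ^ 2 <= g ->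
  g * ((2 ^ r * s) * 2 ^ (r * (2 ^ r * s))) <= n ->
  (forall j, (g - 6 * r) * n <= r * g * #|B j|) ->
  (forall i i' x, i != i' -> x \in B i -> g * ndg x (B i') <= 7 * n) ->
  adj u v ->
  (forall i, i != j -> 40 * r * n <= g * #|[set x in B i | adj u x && adj v x]|) ->
  contains_copy G (Kplus r s).
Proof.
move=> r_gt1 s_gt1 rg MU sB missB uv com.
have g_gt0 : 0 < g by nia.
apply: (@near_complete_Kplus G r s (7 * n %/ g) (40 * r * n %/ g) B j u v) => //.
- by move=> i i' x ii' xB; rewrite leq_divRL // mulnC; apply: missB xB.
- have rg_gt0 : 0 < r * g by rewrite muln_gt0 g_gt0; lia.
  rewrite -(leq_pmul2l rg_gt0); apply: leq_trans (sB j).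
  apply: leq_trans (_ : r * (40 * r * n) <= _).
    by rewrite -mulnA leq_mul2l mulnC leq_trunc_div orbT.
  by rewrite !mulnA leq_mul2r; apply/orP; right; nia.
- by move=> i /com le; rewrite -(leq_pmul2l g_gt0) mulnC; apply: leq_trans le; rewrite leq_trunc_div.
- rewrite leq_divRL //; have := leq_trunc_div (7 * n) g; nia.
- rewrite leq_divRL //; move: MU; set M := _ * 2 ^ _; nia.
Qed.

(** Suppose [v] has many neighbours in every class. A neighbour [u] of [v] in one class sees almost
    all of each other class, hence many neighbours of [v] there, and the edge [u v] yields a
    copy. *)
Lemma near_classes_low (G : sgraph) r s g n (B : 'I_r -> {set G}) :
  1 < r -> 1 < s -> 151 * r ^ 2 <= g ->
  g * ((2 ^ r * s) * 2 ^ (r * (2 ^ r * s))) <= n ->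
  (forall j, (g - 6 * r) * n <= r * g * #|B j|) ->
  (forall i i' x, i != i' -> x \in B i -> g * ndg x (B i') <= 7 * n) ->
  ~ contains_copy G (Kplus r s) ->
  forall v, exists j, g * dg v (B j) <= 50 * r * n.
Proof.
move=> r_gt1 s_gt1 rg MU sB missB noK v; apply/existsP.
apply: contra_notT noK; rewrite negb_exists => /forallP high.
have r_gt0 : 0 < r by lia.
pose j := Ordinal r_gt0.
have /card_gt0P[u] : 0 < dg v (B j).
  by have := high j; rewrite -ltnNge; case: (dg _ _) => //; rewrite muln0.
rewrite inE => /andP[uB vu].
apply: (@near_classes_Kplus _ _ _ g n B j u v) => //; first by rewrite adj_sym.
move=> i ij; have := card_common u v (B i); have := high i; rewrite -ltnNge.
have := missB j i u _ uB; rewrite eq_sym => /(_ ij).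
rewrite -(dg_ndg u (B i)); set a := dg u _; set b := dg v _; set d := ndg _ _.
set e := #|_| => le1 le2 le3.
have : g * (a + b) <= g * (a + d + e) by rewrite leq_mul2l le3 orbT.
nia.
Qed.

Lemma ndg_disjointU (G : sgraph) (v : G) (A B U : {set G}) :
  A \subset U -> B \subset U -> (forall x, x \in A -> x \notin B) ->
  ndg v A + ndg v B <= ndg v U.
Proof.
move=> sAU sBU dAB; rewrite /ndg -cardsUI; set I := _ :&: _.
have -> : I = set0.
  by apply/setP => y; rewrite !inE; case: (boolP (y \in A)) => //= /dAB/negPf->; rewrite andbF.
rewrite cards0 addn0; apply/subset_leq_card/subsetP => y.
by rewrite !inE => /orP[] /andP[] => [/(subsetP sAU)|/(subsetP sBU)] -> ->.
Qed.

(** A vertex with few neighbours ([b]) in one class has spent almost all of its permitted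
    non-neighbours ([e]) on that class ([d]), so few ([f]) remain for another class. *)
Lemma other_class_miss_arith r g u b d e f :
  1 < r -> 151 * r ^ 2 <= g -> (g - 6 * r) * u <= r * g * (b + d) ->
  g * b <= 50 * r * u -> f + d <= e -> r * g * e <= (g + 1) * u ->
  r * g * f <= 54 * r ^ 2 * u.
Proof.
move=> r_gt1 rg le1 le2 le3 le4.
have [h gE] : exists h, g = h + 6 * r by exists (g - 6 * r); nia.
move: le1; rewrite {1}gE addnK => le1.
have : r * g * (f + d) <= r * g * e by rewrite leq_mul2l le3 orbT.
have : r * (g * b) <= r * (50 * r * u) by rewrite leq_mul2l le2 orbT.
have : h * u + 6 * r * u = g * u by rewrite gE mulnDl.
have : r * u * 2 <= r * u * r by rewrite leq_mul2l r_gt1 orbT.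
have : u * 4 <= r ^ 2 * u by rewrite mulnC leq_mul2r; apply/orP; right; nia.
move: le1 le4; rewrite !mulnDr mulnDl mul1n -!mulnn !mulnA; clear; lia.
Qed.

Lemma common_class_arith r g u b x y com :
  1 < r -> 151 * r ^ 2 <= g -> (g - 6 * r) * u <= r * g * b ->
  r * g * x <= 54 * r ^ 2 * u -> r * g * y <= 54 * r ^ 2 * u ->
  b <= x + y + com -> 40 * r * u <= g * com.
Proof.
move=> r_gt1 rg le1 le2 le3 le4; have r_gt0 : 0 < r by lia.
rewrite -(leq_pmul2l r_gt0).
have : r * g * b <= r * g * (x + y + com) by rewrite leq_mul2l le4 orbT.
have : (151 * r ^ 2 - 6 * r) * u <= (g - 6 * r) * u by rewrite leq_mul2r leq_sub2r ?orbT.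
have : 148 * r ^ 2 * u <= (151 * r ^ 2 - 6 * r) * u.
  by rewrite leq_mul2r; apply/orP; right; nia.
move: le1 le2 le3; rewrite !mulnDr -!mulnn !mulnA; move: (_ - _) => h; lia.
Qed.

(** Vertices of [U], including those outside all classes, are coloured by a class where they have
    few neighbours. Two of equal colour see almost all of every other class, so an edge between them
    would give a copy. Hence [U] is r-colourable and Turan's bound applies. *)
Lemma min_degree_structure (G : sgraph) r s g (U : {set G}) :
  1 < r -> 1 < s -> 151 * r ^ 2 <= g ->
  (forall v, v \in U -> (r * g - g - 1) * #|U| <= r * g * dg v U) ->
  g * (((4 * r) ^ r * (g * s)) * 2 ^ (r * ((4 * r) ^ r * (g * s)))) <= #|U| ->
  ~ contains_copy G (Kplus r s) ->
  r * (\sum_(v in U) dg v U) <= (r - 1) * #|U| ^ 2 /\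
  exists B : 'I_r -> {set G},
    [/\ forall i i' x, i != i' -> x \in B i -> x \notin B i',
        g * #|U :\: \bigcup_j B j| <= 5 * #|U|,
        forall j, (g - 6 * r) * #|U| <= r * g * #|B j|,
        forall i i' x, i != i' -> x \in B i -> g * ndg x (B i') <= 7 * #|U| &
        forall v, exists j, g * dg v (B j) <= 50 * r * #|U|].
Proof.
move=> r_gt1 s_gt1 rg degU MU noK.
have [B [sBU dB WB sB mB]] := trace_classes r_gt1 s_gt1 rg degU MU noK.
have M'U : g * ((2 ^ r * s) * 2 ^ (r * (2 ^ r * s))) <= #|U|.
  apply: leq_trans MU; rewrite leq_mul2l; apply/orP; right.
  have le : 2 ^ r * s <= (4 * r) ^ r * (g * s).
    rewrite leq_mul //; last by rewrite leq_pmull //; nia.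
    by rewrite leq_exp2r; lia.
  by rewrite leq_mul // leq_pexp2l // leq_mul2l le orbT.
have low := near_classes_low r_gt1 s_gt1 rg M'U sB mB noK.
split; last by exists B.
apply: (turan_coloring (c := fun v => xchoose (low v))) => x y xU yU cE.
have missE z i : z \in U -> i != xchoose (low z) -> r * g * ndg z (B i) <= 54 * r ^ 2 * #|U|.
  move=> zU ij; have le := xchooseP (low z); set j := xchoose _ in le ij.
  have := sB j; rewrite -(dg_ndg z (B j)) => le1.
  apply: (other_class_miss_arith r_gt1 rg le1 le (e := ndg z U)).
    by apply: ndg_disjointU => // a; apply: dB.
  rewrite -(dg_ndg z U); apply: nonneighbour_arith => //.
  by rewrite (dg_ndg z U); apply: degU.
apply/negP => xy; apply: noK.
apply: (near_classes_Kplus r_gt1 s_gt1 rg M'U sB mB xy (j := xchoose (low x))) => i ij.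
apply: (common_class_arith r_gt1 rg (sB i) (missE x i xU ij) (missE y i yU _)).
  by rewrite -cE.
by have := card_common x y (B i); have := dg_ndg x (B i); have := dg_ndg y (B i); lia.
Qed.

Lemma sum_dg_setD1 (G : sgraph) (U : {set G}) v : v \in U ->
  \sum_(x in U) dg x U = \sum_(x in U :\ v) dg x (U :\ v) + 2 * dg v U.
Proof.
move=> vU; have E x : dg x U = dg x (U :\ v) + adj x v.
  rewrite /dg (cardsD1 v) !inE vU addnC; congr (_ + _).
  by apply: eq_card => y; rewrite !inE andbA.
rewrite (big_setD1 v vU) /= (eq_bigr _ (fun x _ => E x)) big_split /= addnCA.
congr (_ + _); rewrite mul2n -addnn; congr (_ + _).
have -> : dg v U = dg v (U :\ v) by rewrite E adj_irr addn0.
rewrite /dg -sum1_card big_mkcond [RHS]big_mkcond /=; apply: eq_bigr => x _.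
by rewrite [in RHS]inE adj_sym; case: (x \in U :\ v); case: adj.
Qed.

(** [e] and [f] are the degree sums before and after deleting a vertex of degree [d]; the last
    hypothesis is maximality against this deletion. *)
Lemma removal_arith r g u d e f n :
  1 < r -> 0 < g -> 0 < u -> u <= n -> r * g <= u -> e = f + 2 * d ->
  2 * (r * g) * f + (2 * (r * g) - 2 * g - 1) * (n ^ 2 - (u - 1) ^ 2) <=
    2 * (r * g) * e + (2 * (r * g) - 2 * g - 1) * (n ^ 2 - u ^ 2) ->
  (r * g - g - 1) * u <= r * g * d.
Proof.
move=> r_gt1 g_gt0 u_gt0 un rgu -> le.
have [q rE] : exists q, r = q + 2 by exists (r - 2); lia.
have L : 2 * (r * g) - 2 * g - 1 = 2 * (q * g) + 2 * g - 1 by rewrite rE; clear; lia.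
have L' : r * g - g - 1 = q * g + g - 1 by rewrite rE; clear; lia.
move: le; rewrite L L'; set l := 2 * (q * g) + 2 * g - 1.
have lE : 2 * (q * g + g - 1) + 1 = l by rewrite /l; lia.
have : l <= 2 * u by rewrite /l; nia.
rewrite -lE; move: (q * g + g - 1) => k.
have : n ^ 2 - (u - 1) ^ 2 = n ^ 2 - u ^ 2 + (2 * u - 1).
  have : u ^ 2 <= n ^ 2 by rewrite leq_sqr.
  by move: u_gt0 (n ^ 2); clear; case: u => // w _ N; rewrite subn1 /=; lia.
move=> -> lu; rewrite mulnDr [in X in _ <= X -> _]mulnDr; nia.
Qed.

Lemma first_size_arith r g m n u E e :
  1 < r -> 0 < g -> u <= n -> m <= n -> 4 * (r * g * m) <= n ->
  (r - 1) * (n * (n - m)) <= r * E -> e <= u ^ 2 ->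
  2 * (r * g) * E <= 2 * (r * g) * e + (2 * (r * g) - 2 * g - 1) * (n ^ 2 - u ^ 2) ->
  n <= 3 * g * u.
Proof.
move=> r_gt1 g_gt0 un mn mle EE eu le.
have [q rE] : exists q, r = q + 1 by exists (r - 1); lia.
move: EE mle le; rewrite rE addnK => EE mle le.
have L : 2 * ((q + 1) * g) - 2 * g - 1 = 2 * (q * g) - 1 by lia.
have q_gt0 : 0 < q by lia.
have un2 : u ^ 2 <= n ^ 2 by rewrite leq_sqr.
have LE : 2 * (q * g) - 1 + 1 = 2 * (q * g) by nia.
have key : n ^ 2 <= (2 * g + 1) * u ^ 2 + 2 * (q * g) * (n * m).
  move: le; rewrite L; move: LE; set l := _ - 1 => LE le.
  have h1 : 2 * g * (q * (n * (n - m))) <= 2 * g * ((q + 1) * E) by rewrite leq_mul2l EE orbT.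
  have h2 : 2 * ((q + 1) * g) * e <= 2 * ((q + 1) * g) * u ^ 2 by rewrite leq_mul2l eu orbT.
  have h3 : n * (n - m) + n * m = n ^ 2 by rewrite -mulnDr subnK.
  have h4 : n ^ 2 - u ^ 2 + u ^ 2 = n ^ 2 by rewrite subnK.
  move: h1 h2 h3 h4 LE le; move: (n * (n - m)) (n ^ 2 - u ^ 2) (n ^ 2) (u ^ 2) (n * m) => a b c d f.
  clear; nia.
have key2 : n ^ 2 <= 2 * (2 * g + 1) * u ^ 2.
  have : 4 * ((q + 1) * g * m) * n <= n * n by rewrite leq_mul2r mle orbT.
  move: key; rewrite -!mulnn; clear; nia.
rewrite -leq_sqr; apply: leq_trans key2 _.
rewrite [leqRHS]expnMn leq_mul2r; apply/orP; right.
by move: g_gt0; clear; case: g => // g _; lia.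
Qed.

Lemma final_size_arith r g m n u E e :
  1 < r -> 0 < g -> u <= n -> m <= n -> 0 < n ->
  (r - 1) * (n * (n - m)) <= r * E -> r * e <= (r - 1) * u ^ 2 ->
  2 * (r * g) * E <= 2 * (r * g) * e + (2 * (r * g) - 2 * g - 1) * (n ^ 2 - u ^ 2) ->
  n - u <= 2 * (r * g) * m.
Proof.
move=> r_gt1 g_gt0 un mn n_gt0 EE eu le.
have [q rE] : exists q, r = q + 1 by exists (r - 1); lia.
move: EE eu le; rewrite rE addnK => EE eu le.
have L : 2 * ((q + 1) * g) - 2 * g - 1 = 2 * (q * g) - 1 by lia.
have q_gt0 : 0 < q by lia.
have un2 : u ^ 2 <= n ^ 2 by rewrite leq_sqr.
have LE : 2 * (q * g) - 1 + 1 = 2 * (q * g) by nia.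
have key : n ^ 2 <= u ^ 2 + 2 * (q * g) * (n * m).
  move: le; rewrite L; move: LE; set l := _ - 1 => LE le.
  have h1 : 2 * g * (q * (n * (n - m))) <= 2 * g * ((q + 1) * E) by rewrite leq_mul2l EE orbT.
  have h2 : 2 * g * ((q + 1) * e) <= 2 * g * (q * u ^ 2) by rewrite leq_mul2l eu orbT.
  have h3 : n * (n - m) + n * m = n ^ 2 by rewrite -mulnDr subnK.
  have h4 : n ^ 2 - u ^ 2 + u ^ 2 = n ^ 2 by rewrite subnK.
  move: h1 h2 h3 h4 LE le; move: (n * (n - m)) (n ^ 2 - u ^ 2) (n ^ 2) (u ^ 2) (n * m) => a b c d f.
  clear; nia.
rewrite -(leq_pmul2r n_gt0).
have [d nE] : exists d, n = u + d by exists (n - u); lia.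
move: key; rewrite nE addKn -!mulnn; clear; nia.
Qed.

(** The size of the optimal [U] is estimated twice. The trivial bound on its degree sum gives
    [|U| >= n / (3 g)], enough for [min_degree_structure]; the resulting Turan bound then leaves at
    most [2 r g m] vertices outside [U]. *)
Lemma near_extremal_structure (G : sgraph) r s g m :
  1 < r -> 1 < s -> 151 * r ^ 2 <= g ->
  (r - 1) * (#|G| * (#|G| - m)) <= r * \sum_(v : G) dg v setT ->
  0 < m -> 4 * (g ^ 2 * r * m) <= #|G| ->
  3 * g ^ 2 * (((4 * r) ^ r * (g * s)) * 2 ^ (r * ((4 * r) ^ r * (g * s)))) <= #|G| ->
  ~ contains_copy G (Kplus r s) ->
  exists B : 'I_r -> {set G},
    [/\ g * #|~: \bigcup_j B j| <= 6 * #|G|,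
        forall j, (g - 6 * r - 1) * #|G| <= r * g * #|B j|,
        forall i i' x, i != i' -> x \in B i -> g * ndg x (B i') <= 7 * #|G| &
        forall v, exists j, g * dg v (B j) <= 50 * r * #|G|].
Proof.
move=> r_gt1 s_gt1 rg degG m_gt0 mn Mn noK.
have g_gt0 : 0 < g by nia.
set n := #|G| in degG mn Mn *.
have mn' : 4 * (r * g * m) <= n.
  by apply: leq_trans mn; rewrite -mulnn; nia.
have mn0 : m <= n.
  by apply: leq_trans mn'; rewrite mulnA leq_pmull // !muln_gt0 g_gt0; lia.
have n_gt0 : 0 < n by lia.
(* Up to the constant (2rg - 2g - 1) n^2, which keeps it nonnegative, F U is
   2rg e(U) - (2rg - 2g - 1) |U|^2, where e counts ordered pairs; maximality
   under deleting one vertex gives the minimum degree. *)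
pose F (U : {set G}) := 2 * (r * g) * (\sum_(x in U) dg x U) +
  (2 * (r * g) - 2 * g - 1) * (n ^ 2 - #|U| ^ 2).
have [U _ maxU] := @arg_maxnP _ setT xpredT F isT.
have un : #|U| <= n by apply: max_card.
have FT : 2 * (r * g) * (\sum_(v : G) dg v setT) <= F U.
  apply: leq_trans (maxU setT isT); rewrite /F; apply: leq_trans (leq_addr _ _).
  by rewrite leq_mul2l; apply/orP; right; apply: eq_leq; apply: eq_bigl => x; rewrite inE.
have size1 : n <= 3 * g * #|U|.
  apply: (first_size_arith r_gt1 g_gt0 un mn0 mn' degG _ FT).
  by rewrite -mulnn -sum_nat_const; apply: leq_sum => x _; rewrite -[leqRHS](dg_ndg x) leq_addr.
have rgu : r * g <= #|U|.
  have g3 : 0 < 3 * g by rewrite muln_gt0.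
  rewrite -(leq_pmul2l g3); apply: leq_trans size1; apply: leq_trans mn.
  by rewrite -mulnn; nia.
have u_gt0 : 0 < #|U| by apply: leq_trans rgu; rewrite muln_gt0 g_gt0; lia.
have degU v : v \in U -> (r * g - g - 1) * #|U| <= r * g * dg v U.
  move=> vU; apply: (removal_arith r_gt1 g_gt0 u_gt0 un rgu (sum_dg_setD1 vU)).
  have E : #|U :\ v| = #|U| - 1 by rewrite [in RHS](cardsD1 v) vU addKn.
  by have := maxU (U :\ v) isT; rewrite /F E.
have [|eU [B [dB WB sB mB lowB]]] := min_degree_structure r_gt1 s_gt1 rg degU _ noK.
  have g3 : 0 < 3 * g by rewrite muln_gt0.
  rewrite -(leq_pmul2l g3); apply: leq_trans size1; apply: leq_trans Mn.
  by rewrite mulnA -(mulnA 3) mulnn.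
have size2 := final_size_arith r_gt1 g_gt0 un mn0 n_gt0 degG eU FT.
have size3 : g * (n - #|U|) <= n.
  apply: leq_trans (_ : g * (2 * (r * g) * m) <= _); first by rewrite leq_mul2l size2 orbT.
  have -> : g * (2 * (r * g) * m) = 2 * (g ^ 2 * r * m) by clear; lia.
  by move: mn; clear; lia.
exists B; split=> [|j|i i' x ii' xB|v].
- have : #|~: \bigcup_j B j| <= #|U :\: \bigcup_j B j| + (n - #|U|).
    rewrite -(cardsID U) setIC -setDE leq_add2l.
    have -> : n - #|U| = #|~: U| by rewrite [RHS]cardsCs setCK.
    by rewrite setDE subset_leq_card // subsetIr.
  move=> le; apply: leq_trans (_ : g * (#|U :\: \bigcup_j B j| + (n - #|U|)) <= _).
    by rewrite leq_mul2l le orbT.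
  by rewrite mulnDr; move: WB size3 un; lia.
- have g6 : 6 * r + 1 <= g by move: r_gt1 rg; clear; rewrite -mulnn; nia.
  apply: leq_trans (sB j); rewrite -subnDA.
  have [h gE] : exists h, g = h + (6 * r + 1) by exists (g - (6 * r + 1)); lia.
  move: size3; rewrite gE addnK => size3.
  have -> : h + (6 * r + 1) - 6 * r = h + 1 by lia.
  have [d nE] : exists d, n = #|U| + d by exists (n - #|U|); lia.
  by move: size3; rewrite nE addKn mulnDr !mulnDl mul1n; clear; lia.
- by apply: leq_trans (mB i i' x ii' xB) _; rewrite leq_mul2l.
- by have [j le] := lowB v; exists j; apply: leq_trans le _; rewrite leq_mul2l un orbT.
Qed.

(** * Colour counts in the parts *)

Section CountingColours.

Variables (G : sgraph) (l r m : nat) (pt : G -> 'I_l) (c : G -> 'I_r).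

Definition part (i : 'I_l) : {set G} := [set v | pt v == i].
Definition part_colour (i : 'I_l) (a : 'I_r) := #|[set v in part i | c v == a]|.
Definition mono_adj : rel G := fun x y => adj x y && (c x == c y).

Lemma mono_adj_sym : symmetric mono_adj.
Proof. by move=> x y; rewrite /mono_adj adj_sym eq_sym. Qed.

Lemma mono_adj_irr : irreflexive mono_adj.
Proof. by move=> x; rewrite /mono_adj adj_irr. Qed.

(** Edges inside colours form a graph of their own, so the general degree lemmas apply to [bad]. *)
Definition mono_graph : sgraph := SGraph mono_adj_sym mono_adj_irr.

Definition bad (v : G) (A : {set G}) := dg (v : mono_graph) A.
Definition miss (v : G) (A : {set G}) :=
  #|[set y in A | (c y != c v) && ~~ adj v y]|.

(** This counts the equally coloured pairs between two parts, as a scalar product of colour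
    vectors. *)
Definition inner (i j : 'I_l) := \sum_a part_colour i a * part_colour j a.

Hypothesis card_part : forall i, #|part i| = m.

Lemma sum_part_colour i : \sum_a part_colour i a = m.
Proof.
rewrite -(card_part i) -sum1_card (partition_big c predT) //=.
by apply: eq_bigr => a _; rewrite sum1dep_card.
Qed.

(** A vertex of another colour counts once on the left, in [dg] or in [miss]. One of the same colour
    counts in the last set, and once more on both sides if it is adjacent to [v]. *)
Lemma dg_miss_bad (v : G) (A : {set G}) :
  dg v A + miss v A + #|[set y in A | c y == c v]| = #|A| + bad v A.
Proof.
have E (D : {set G}) : #|D| = \sum_(x : G) (x \in D : nat).
  by rewrite -sum1_card big_mkcond.
rewrite /dg /miss /bad /dg !E -!big_split /=.
apply: eq_bigr => y _; rewrite !inE /= /mono_adj (eq_sym (c v)).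
by case: (y \in A); case: adj; case: (_ == _).
Qed.

Lemma sum_part_colour_class i j :
  \sum_(v in part i) #|[set y in part j | c y == c v]| = inner i j.
Proof.
rewrite (partition_big c predT) //=; apply: eq_bigr => a _.
rewrite (eq_bigr (fun=> part_colour j a)); last by move=> v /andP[_ /eqP->].
by rewrite sum_nat_cond_const /part_colour cardsE.
Qed.

Lemma pair_count i j :
  \sum_(v in part i) dg v (part j) + \sum_(v in part i) miss v (part j) + inner i j =
  m ^ 2 + \sum_(v in part i) bad v (part j).
Proof.
rewrite -sum_part_colour_class -!big_split /= -mulnn -{1}(card_part i) -sum_nat_const.
by rewrite -big_split; apply: eq_bigr => v _; rewrite dg_miss_bad card_part.
Qed.

Lemma inner_diag i : inner i i <= m ^ 2.
Proof.
rewrite -mulnn -{1}(sum_part_colour i) big_distrl /=; apply: leq_sum => a _.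
by rewrite leq_mul2l -(sum_part_colour i) (bigD1 a) //= leq_addr orbT.
Qed.

End CountingColours.

Arguments part {G l} pt i.

(** * Orderings of colour counts and the equality case of Chebyshev's inequality *)

Definition sorts r (p : 'S_r) (f : 'I_r -> nat) :=
  [forall a : 'I_r, forall b : 'I_r, (a <= b) ==> (f (p b) <= f (p a))].

Lemma sortsP r (p : 'S_r) (f : 'I_r -> nat) :
  reflect (forall a b : 'I_r, a <= b -> f (p b) <= f (p a)) (sorts p f).
Proof.
apply: (iffP forallP) => [h a b|h a]; first by have /forallP/(_ b)/implyP := h a.
by apply/forallP => b; apply/implyP => /h.
Qed.

Lemma exists_sorts r (f : 'I_r -> nat) : exists p : 'S_r, sorts p f.
Proof.
pose leT := fun a b : 'I_r => f b <= f a.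
pose t := sort leT (enum 'I_r).
have st : size t = r by rewrite size_sort size_enum_ord.
have ut : uniq t by rewrite sort_uniq enum_uniq.
pose h (a : 'I_r) : 'I_r := nth a t a.
have h_inj : injective h.
  move=> a b; rewrite /h (set_nth_default a b) ?st // => /eqP.
  by rewrite nth_uniq ?st // => /eqP/val_inj.
exists (perm h_inj); apply/sortsP => a b ab; rewrite !permE /h.
rewrite (set_nth_default a b) ?st //.
have tr : transitive leT by move=> y x z xy yz; apply: leq_trans yz xy.
have tot : total leT by move=> x y; apply: leq_total.
have : sorted leT t by apply: sort_sorted.
by move/(sorted_leq_nth tr (fun x => leqnn _)) => /(_ a a b); rewrite !inE st; apply.
Qed.

Lemma sorts_similar r (p : 'S_r) (f h : 'I_r -> nat) : sorts p f -> sorts p h ->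
  forall i j, (f i <= f j) && (h i <= h j) || (f j <= f i) && (h j <= h i).
Proof.
move=> /sortsP sf /sortsP sh i j; rewrite -(permKV p i) -(permKV p j).
set a := (p^-1)%g i; set b := (p^-1)%g j.
by case/orP: (leq_total a b) => ab; rewrite (sf _ _ ab) (sh _ _ ab) ?orbT.
Qed.

Definition constant_colours r (f : 'I_r -> nat) := [forall a, forall b, f a == f b].

Lemma constant_coloursP r (f : 'I_r -> nat) :
  reflect (forall a b, f a = f b) (constant_colours f).
Proof.
apply: (iffP forallP) => [h a b|h a]; first by have /forallP/(_ b)/eqP := h a.
by apply/forallP => b; apply/eqP.
Qed.

(** Equality in Chebyshev's inequality, read at the first and last positions of the common order,
    says that the product of the two ranges (maximum minus minimum) vanishes. *)
Lemma sorts_tight_constant r (p : 'S_r) (f h : 'I_r -> nat) :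
  sorts p f -> sorts p h ->
  r * (\sum_i f i * h i) <= (\sum_i f i) * (\sum_i h i) ->
  constant_colours f || constant_colours h.
Proof.
move=> sf sh le; have tight := chebyshev_eq (sorts_similar sf sh) le.
case: r p f h sf sh {le} tight => [|r] p f h sf sh tight.
  by apply/orP; left; apply/forallP => -[].
have E (k : 'I_r.+1 -> nat) : sorts p k -> k (p ord0) <= k (p ord_max) -> constant_colours k.
  move=> /sortsP sk le; apply/constant_coloursP.
  suff H a : k a = k (p ord0) by move=> a b; rewrite !H.
  rewrite -(permKV p a); apply/eqP; rewrite eqn_leq sk //=.
  by apply: leq_trans le _; rewrite sk // leq_ord.
case: (leqP (f (p ord0)) (f (p ord_max))) => [/(E f sf) -> //|lt1].
case: (leqP (h (p ord0)) (h (p ord_max))) => [/(E h sh) ->|lt2]; first by rewrite orbT.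
by have := tight (p ord0) (p ord_max); nia.
Qed.

(** The hypothesis says that the squares [(2 r Y i - 2 S)^2] sum to at most [S^2]. An index with
    [2 r Y a < S] would alone contribute more, which [gap] records. *)
Lemma dispersion r (Y : 'I_r -> nat) S a :
  \sum_i Y i = S -> 4 * r ^ 2 * (\sum_i Y i * Y i) <= (4 * r + 1) * S ^ 2 ->
  S <= 2 * r * Y a.
Proof.
move=> sY le; rewrite leqNgt; apply/negP => lt.
pose gap (i : 'I_r) := if i == a then S ^ 2 + 1 else 0.
have pt i : 8 * r * Y i * S + gap i <= 4 * r ^ 2 * (Y i * Y i) + 4 * S ^ 2.
  rewrite /gap; case: eqP => [->|_]; last first.
    by rewrite addn0; have := (nat_Cauchy (r * Y i) S).1; clear; nia.
  have [d dE] : exists d, S = 2 * r * Y a + d.+1 by exists (S - 2 * r * Y a).-1; lia.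
  rewrite dE -!mulnn; clear; nia.
have : \sum_i (8 * r * Y i * S + gap i) <=
    \sum_i (4 * r ^ 2 * (Y i * Y i) + 4 * S ^ 2) by apply: leq_sum.
rewrite big_split [leqRHS]big_split sum_nat_const card_ord /= -big_distrl -!big_distrr /= sY.
rewrite (bigD1 a) //= big1 => [|i /negPf ia]; last by rewrite /gap ia.
rewrite /gap eqxx addn0; move: le; clear.
move: (\sum_i _) => Z; rewrite -!mulnn. nia.
Qed.

(** * A cluster of similarly ordered parts *)

Lemma dg_partition (G : sgraph) l (pt : G -> 'I_l) (Q : {set 'I_l}) v :
  dg v [set x | pt x \in Q] = \sum_(j in Q) dg v (part pt j).
Proof.
rewrite /dg -sum1_card (partition_big pt (mem Q)) /=; last first.
  by move=> x; rewrite !inE => /andP[].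
apply: eq_bigr => j jQ; rewrite sum1dep_card; apply: eq_card => x.
by rewrite !inE; case: eqP => [->|]; rewrite ?jQ ?andbT ?andbF.
Qed.

Lemma sum_parts (G : sgraph) l (pt : G -> 'I_l) (Q : {set 'I_l}) (F : G -> nat) :
  \sum_(v in [set x | pt x \in Q]) F v = \sum_(i in Q) \sum_(v in part pt i) F v.
Proof.
rewrite (partition_big pt (mem Q)) /=; last by move=> x; rewrite inE.
apply: eq_bigr => j jQ; apply: eq_bigl => x.
by rewrite !inE; case: eqP => [->|]; rewrite ?jQ ?andbF.
Qed.

Section Cluster.

Variables (G : sgraph) (l r m : nat) (pt : G -> 'I_l) (c : G -> 'I_r).
Variable Q : {set 'I_l}.

Let X := [set v | pt v \in Q].
Let S := #|Q| * m.

(** The part of [v] itself is left out, since its non-edges are forced. *)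
Definition miss_in (v : G) := \sum_(j in Q | j != pt v) miss c v (part pt j).

Hypothesis r_gt1 : 1 < r.
Hypothesis card_part : forall i, #|part pt i| = m.
Hypothesis part_indep : forall x y, pt x = pt y -> ~~ adj x y.

Lemma card_cluster : #|X| = S.
Proof.
rewrite -sum1_card sum_parts /S -sum_nat_const; apply: eq_bigr => i _.
by rewrite sum1_card card_part.
Qed.

Lemma bad_in v : bad c v X = \sum_(j in Q | j != pt v) bad c v (part pt j).
Proof.
rewrite /bad (dg_partition (G := mono_graph c)) [RHS]big_mkcondr /=.
apply: eq_bigr => j _; case: eqP => //= ->; apply/eqP.
rewrite cards_eq0; apply/eqP/setP => x; rewrite !inE /= /mono_adj.
by case: eqP => //= /esym/part_indep/negPf ->.
Qed.

Lemma miss_in_set v :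
  #|[set y in X | [&& c y != c v, pt y != pt v & ~~ adj v y]]| <= miss_in v.
Proof.
apply: leq_trans (card_bigcup_le _ _); apply/subset_leq_card/subsetP => y.
rewrite !inE => /and4P[yQ cy py vy]; apply/bigcupP; exists (pt y).
  by rewrite yQ.
by rewrite !inE eqxx cy vy.
Qed.

Lemma sum_pairs (f : G -> 'I_l -> nat) :
  \sum_(v in X) \sum_(j in Q | j != pt v) f v j =
  \sum_(i in Q) \sum_(j in Q | j != i) \sum_(v in part pt i) f v j.
Proof.
rewrite sum_parts; apply: eq_bigr => i _; rewrite exchange_big /=.
under eq_bigr => v vi do [move: vi; rewrite inE => /eqP ->; over].
by [].
Qed.

Section TypicalVertices.

Variables (s g : nat) (B : 'I_r -> {set G}).
Hypothesis s_gt1 : 1 < s.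
Hypothesis g_gt0 : 0 < g.
Hypothesis rest_small : g * #|~: \bigcup_j B j| <= 6 * #|G|.
Hypothesis class_miss :
  forall i i' x, i != i' -> x \in B i -> g * ndg x (B i') <= 7 * #|G|.
Hypothesis class_colour : forall i x, x \in B i -> c x = i.
Hypothesis cluster_large : 2048 * r ^ 3 * #|G| <= g * S.
Hypothesis part_small : 32 * r ^ 2 * m <= S.
Hypothesis S_large : 8 * r * ((2 ^ r * s) * 2 ^ (r * (2 ^ r * s))) <= S.
Hypothesis balance : forall a, S <= 2 * r * #|[set x in X | c x == a]|.
Hypothesis noK : ~ contains_copy G (Kplus r s).

Let r_gt0 : 0 < r. Proof. exact: ltnW. Qed.

Let scale k b : k <= 112 * r ^ 2 -> g * b <= k * #|G| -> g * b <= g * S.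
Proof.
move=> kr le; apply: leq_trans le _; apply: leq_trans cluster_large.
by rewrite leq_mul2r; apply/orP; right; move: r_gt0 kr; clear; nia.
Qed.

(** By [balance] each colour has at least [S / (2 r)] vertices in the cluster. Typical vertices lose
    few of them, so [S / (4 r)] common neighbours remain in every other colour and an edge would
    give a copy. [u] and [v] may lie outside the cluster. *)
Lemma typical_independent u v :
  16 * r * miss_in u <= S -> 16 * r * miss_in v <= S -> c u = c v -> ~~ adj u v.
Proof.
move=> tu tv cuv; apply/negP => uv; apply: noK.
have r4 : 0 < 4 * r by rewrite muln_gt0.
have rest : 16 * r * #|~: \bigcup_j B j| <= S.
  rewrite -(leq_pmul2l g_gt0); apply: (@scale (96 * r)); first by move: r_gt1; clear; nia.
  by move: rest_small; clear; nia.
have m16 : 32 * r * m <= S.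
  by apply: leq_trans part_small; rewrite leq_mul2r; apply/orP; right; move: r_gt0; clear; nia.
apply: (@near_complete_Kplus G r s (7 * #|G| %/ g) (S %/ (4 * r)) (fun i => B i :&: X) (c u) u v) => //.
- move=> i i' x ii'; rewrite inE => /andP[xB _]; rewrite leq_divRL // mulnC.
  apply: leq_trans (class_miss ii' xB); rewrite leq_mul2l sub_ndg ?orbT //.
  exact: subsetIl.
- have sub : [set x in X | c x == c u] \subset (B (c u) :&: X) :|: ~: \bigcup_j B j.
    apply/subsetP => x; rewrite !inE => /andP[-> /eqP cx]; rewrite andbT -cx.
    case: (boolP (x \in \bigcup_j B j)) => [/bigcupP[k _ xB]|_]; last by rewrite /= !orbT.
    by rewrite (class_colour xB) xB.
  have := subset_leq_card sub; rewrite cardsU => le.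
  have le' : #|[set x in X | c x == c u]| <= #|B (c u) :&: X| + #|~: \bigcup_j B j| by lia.
  have := balance (c u); have := leq_trunc_div S (4 * r).
  move: le' rest; move: #|_ :&: _| #|~: _| #|[set x in X | _]| (S %/ _) => a b d z.
  move: S r_gt0; clear => S0 r0 le1 le2 le3 le4; rewrite -(leq_pmul2l r0); nia.
- move=> i iu.
  set C := [set x in B i :&: X | adj u x && adj v x].
  pose M w := [set y in X | [&& c y != c w, pt y != pt w & ~~ adj w y]].
  (* A vertex of colour [i] is a common neighbour, lies in no class, or is missed by or shares the
     part of [u] or [v]. *)
  have sub : [set x in X | c x == i] \subset
      C :|: ~: (\bigcup_j B j) :|: (M u :|: part pt (pt u)) :|: (M v :|: part pt (pt v)).
    apply/subsetP => x; rewrite !inE => /andP[-> /eqP cx].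
    case: (boolP (x \in \bigcup_j B j)) => [/bigcupP[k _ xB]|_]; last by rewrite /= !orbT.
    have ki : k = i by rewrite -cx (class_colour xB).
    rewrite ki in xB; rewrite xB -cuv cx iu /= orbF.
    by case: (pt x == pt u); case: (pt x == pt v); case: (adj u x); case: (adj v x).
  have cU (D E : {set G}) : #|D :|: E| <= #|D| + #|E| by rewrite cardsU leq_subr.
  have : #|[set x in X | c x == i]| <=
      #|C| + #|~: \bigcup_j B j| + (miss_in u + m) + (miss_in v + m).
    apply: leq_trans (subset_leq_card sub) _.
    apply: leq_trans (cU _ _) _; apply: leq_add; last first.
      by apply: leq_trans (cU _ _) _; rewrite card_part leq_add2r miss_in_set.
    apply: leq_trans (cU _ _) _; apply: leq_add; last first.
      by apply: leq_trans (cU _ _) _; rewrite card_part leq_add2r miss_in_set.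
    exact: cU.
  have := balance i; have := leq_trunc_div S (4 * r); move: rest m16 tu tv.
  move: #|C| #|~: _| #|[set x in X | _]| (S %/ _) (miss_in u) (miss_in v) => a b d z mu mv.
  move: S r_gt0; clear => S0 r0 h1 h2 h3 h4 h5 h6 h7; rewrite -(leq_pmul2l r0); nia.
- rewrite leq_divRL // -(leq_pmul2l g_gt0).
  have := leq_trunc_div (7 * #|G|) g; move: (7 * #|G| %/ g) => mu le.
  by apply: (@scale (112 * r ^ 2)) => //; move: le; clear; nia.
- by rewrite leq_divRL //; move: S_large; move: (_ * 2 ^ _) => M; clear; nia.
Qed.

End TypicalVertices.

End Cluster.

(** * Rigidity of the cluster *)

Section ClusterRigidity.

Variables (G : sgraph) (l r m : nat) (pt : G -> 'I_l) (c : G -> 'I_r).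
Variables (Q : {set 'I_l}) (p : 'S_r).

Let X := [set v | pt v \in Q].
Let S := #|Q| * m.
Let typical v := 16 * r * miss_in pt c Q v <= S.
Let colours i := part_colour pt c i.

Hypothesis r_gt1 : 1 < r.
Hypothesis card_part : forall i, #|part pt i| = m.
Hypothesis part_indep : forall x y, pt x = pt y -> ~~ adj x y.
Hypothesis dense : forall i j, i != j ->
  (r - 1) * m ^ 2 <= r * \sum_(v in part pt i) dg v (part pt j).
Hypothesis sortsQ : forall i, i \in Q -> sorts p (colours i).
Hypothesis bad_small : forall v, 16 * r ^ 2 * (bad c v X + m) <= S.

Let r_gt0 : 0 < r. Proof. exact: ltnW. Qed.

Let m2 : r * m ^ 2 = (r - 1) * m ^ 2 + m ^ 2.
Proof. by rewrite -{3}[m ^ 2]mul1n -mulnDl subnK. Qed.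

Lemma inner_le_bad i j : i != j ->
  r * inner pt c i j <= m ^ 2 + r * \sum_(v in part pt i) bad c v (part pt j).
Proof.
move=> ij; have := dense ij; have := pair_count c card_part i j.
move: m2; move: (\sum_(v in part pt i) dg v (part pt j)) (\sum_(v in part pt i) miss c v (part pt j))
  (\sum_(v in part pt i) bad c v (part pt j)) (m ^ 2) (r - 1) (inner pt c i j).
clear; nia.
Qed.

(** Similar ordering gives [inner >= m^2 / r] and density gives at least [(1 - 1/r) m^2] edges;
    [pair_count] then leaves no surplus of [miss] over [bad]. *)
Lemma miss_le_bad i j : i \in Q -> j \in Q -> i != j ->
  \sum_(v in part pt i) miss c v (part pt j) <= \sum_(v in part pt i) bad c v (part pt j).
Proof.
move=> iQ jQ ij; have := dense ij; have := pair_count c card_part i j.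
have := chebyshev_sum (sorts_similar (sortsQ iQ) (sortsQ jQ)).
rewrite !(sum_part_colour c card_part) mulnn -/(inner pt c i j).
move: m2 r_gt0.
move: (\sum_(v in part pt i) dg v (part pt j)) (\sum_(v in part pt i) miss c v (part pt j))
  (\sum_(v in part pt i) bad c v (part pt j)) (m ^ 2) (r - 1) (inner pt c i j).
clear => a b d e f h h1 h0 h2 h3 h4; rewrite -(leq_pmul2l h0); nia.
Qed.

Lemma sum_miss_le_bad : \sum_(v in X) miss_in pt c Q v <= \sum_(v in X) bad c v X.
Proof.
under [leqRHS]eq_bigr => v _ do rewrite bad_in //.
rewrite /miss_in !(sum_pairs pt Q); apply: leq_sum => i iQ.
by apply: leq_sum => j /andP[jQ ji]; apply: miss_le_bad; rewrite // eq_sym.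
Qed.

(** The squared colour totals sum to [inner] over all pairs of cluster parts. By [inner_le_bad] this
    is close to the minimum [S^2 / r], so [dispersion] applies. *)
Lemma cluster_balance a : S <= 2 * r * #|[set x in X | c x == a]|.
Proof.
pose Y a := \sum_(i in Q) colours i a.
have -> : #|[set x in X | c x == a]| = Y a.
  rewrite -sum1_card (partition_big pt (mem Q)) /=; last first.
    by move=> x; rewrite !inE => /andP[].
  apply: eq_bigr => i iQ; rewrite sum1dep_card; apply: eq_card => x.
  by rewrite !inE; case: (pt x =P i) => [->|]; rewrite ?iQ ?andbT ?andbF.
have sY : \sum_a Y a = S.
  rewrite exchange_big /S -sum_nat_const; apply: eq_bigr => i _.
  exact: sum_part_colour.
apply: dispersion => //.
have YY : \sum_a Y a * Y a = \sum_(i in Q) \sum_(j in Q) inner pt c i j.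
  under eq_bigr do rewrite big_distrlr.
  by rewrite exchange_big; apply: eq_bigr => i _; rewrite exchange_big.
have badX : 16 * r ^ 2 * (\sum_(v in X) bad c v X + S * m) <= S * S.
  have cX : #|X| = S := card_cluster Q card_part.
  rewrite -{1 2}cX -!sum_nat_const -big_split big_distrr /=.
  by apply: leq_sum => v _.
have le : r * (\sum_a Y a * Y a) <= S * S + r * (S * m) + r * \sum_(v in X) bad c v X.
  under [\sum_(v in X) _]eq_bigr => v _ do rewrite bad_in //.
  rewrite YY (sum_pairs pt Q) !big_distrr /=.
  have -> : S * S + r * (S * m) = \sum_(i in Q) (\sum_(j in Q) m ^ 2 + r * m ^ 2).
    by rewrite !sum_nat_const /S -!mulnn; clear; lia.
  rewrite -big_split; apply: leq_sum => i iQ /=.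
  rewrite [X in r * X](bigD1 i) //= [X in X + _ + _](bigD1 i) //= mulnDr.
  have : r * inner pt c i i <= r * m ^ 2 by rewrite leq_mul2l inner_diag ?orbT.
  set s1 := \sum_(j in Q | _) inner _ _ _ _; set s2 := \sum_(j in Q | _) _ ^ _.
  set s3 := \sum_(j in Q | _) \sum_(v in _) _.
  have : r * s1 <= s2 + r * s3.
    rewrite !big_distrr -big_split; apply: leq_sum => j /andP[_ ji] /=.
    by apply: inner_le_bad; rewrite eq_sym.
  clear; lia.
move: le badX; rewrite -!mulnn; move: (\sum_a _) (\sum_(v in X) _) S.
by clear -r_gt1 => y b s0 le1 le2; nia.
Qed.

Hypothesis typical_indep :
  forall u v, typical u -> typical v -> c u = c v -> ~~ adj u v.

Lemma atypical_miss v : ~~ typical v -> 2 * bad c v X + 2 * m < miss_in pt c Q v.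
Proof.
rewrite /typical -ltnNge => lt; have r16 : 0 < 16 * r by rewrite muln_gt0.
rewrite -(ltn_pmul2l r16); apply: leq_ltn_trans lt; apply: leq_trans (bad_small v).
by move: r_gt1; clear; nia.
Qed.

(** Every edge inside a colour has an end in the atypical set [W], so the total of [bad] is at most
    twice its sum over [W]. If [W] were non-empty, that would be less than the sum of [miss_in] over
    [W], contradicting [sum_miss_le_bad]. *)
Lemma cluster_typical v : v \in X -> typical v.
Proof.
pose W := [set v in X | ~~ typical v].
have sWX : W \subset X by apply/subsetP => x; rewrite inE => /andP[].
have le1 : \sum_(v in X :\: W) bad c v X <= \sum_(v in W) bad c v X.
  have -> : \sum_(v in W) bad c v X = \sum_(v in X) bad c v W.
    exact: (exchange_dg (G := mono_graph c)).
  rewrite [leqRHS](big_setID W) /= (setIidPr sWX).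
  apply: leq_trans (leq_addl _ _); apply: leq_sum => x.
  rewrite !inE negb_and negbK => /andP[xW xX]; rewrite xX /= in xW.
  apply/subset_leq_card/subsetP => y; rewrite !inE /= /mono_adj.
  case/andP=> yX /andP[xy /eqP cxy]; rewrite yX xy cxy eqxx !andbT /=.
  by apply: contraTN xy => ty; apply: typical_indep.
have le3 := sum_miss_le_bad.
rewrite (big_setID W) [leqRHS](big_setID W) /= (setIidPr sWX) in le3.
have le2 : 2 * \sum_(v in W) bad c v X + #|W| <= \sum_(v in W) miss_in pt c Q v.
  rewrite -sum1_card big_distrr -big_split; apply: leq_sum => x /=.
  rewrite inE => /andP[_ /atypical_miss]; clear; lia.
have : #|W| = 0 by move: le1 le2 le3; clear; lia.
move/eqP; rewrite cards_eq0 => /eqP W0 vX; apply: contraT => nt.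
by have := in_set0 v; rewrite -W0 inE vX nt.
Qed.

Lemma cluster_bad v : v \in X -> bad c v X = 0.
Proof.
move=> vX; apply/eqP; rewrite cards_eq0; apply/eqP/setP => y.
rewrite !inE /= /mono_adj; apply/negP => /and3P[yQ vy /eqP cvy].
have yX : y \in X by rewrite inE.
by have := typical_indep (cluster_typical vX) (cluster_typical yX) cvy; rewrite vy.
Qed.

Lemma cluster_constant i j : i \in Q -> j \in Q -> i != j ->
  constant_colours (colours i) || constant_colours (colours j).
Proof.
move=> iQ jQ ij; apply: (sorts_tight_constant (sortsQ iQ) (sortsQ jQ)).
rewrite !(sum_part_colour c card_part) mulnn -/(inner pt c i j).
apply: leq_trans (inner_le_bad ij) _; rewrite big1 ?muln0 ?addn0 // => v.
rewrite inE => /eqP vi; apply/eqP; rewrite -leqn0 -(@cluster_bad v) ?inE ?vi //.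
apply: (sub_dg (G := mono_graph c)); apply/subsetP => y.
by rewrite !inE => /eqP ->.
Qed.

(** The part of [v] is compared with the constant parts [J] of the cluster. Density gives total [Ms]
    at most total [Bd] over this part, while each vertex has [Bd <= Ms], strictly if it is
    atypical. *)
Lemma all_typical v : typical v.
Proof.
pose pv := pt v.
pose J := [set j in Q | constant_colours (colours j) && (j != pv)].
have sJQ : {subset J <= Q} by move=> j; rewrite inE => /andP[].
have nJ j : j \in J -> j != pv by rewrite inE => /and3P[].
have cJ j (a : 'I_r) : j \in J -> r * colours j a = m.
  rewrite inE => /and3P[_ /constant_coloursP cj _].
  rewrite -(sum_part_colour c card_part j) -{1}(card_ord r) -sum_nat_const.
  by apply: eq_bigr => b _; apply: cj.
pose D x := \sum_(j in J) dg x (part pt j).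
pose Ms x := \sum_(j in J) miss c x (part pt j).
pose Bd x := \sum_(j in J) bad c x (part pt j).
(* In a constant part each colour has [m / r] vertices, so the colour of [x] does not matter and no
   ordering of its part is needed. *)
have count x : r * D x + r * Ms x + #|J| * m = r * (#|J| * m) + r * Bd x.
  rewrite -!sum_nat_const !big_distrr -!big_split /=; apply: eq_bigr => j jJ.
  rewrite -[in LHS](cJ j (c x) jJ) -!mulnDr dg_miss_bad.
  by rewrite card_part.
have BdX x : Bd x <= bad c x X.
  rewrite /bad (dg_partition (G := mono_graph c)) /Bd big_mkcond [leqRHS]big_mkcond.
  by apply: leq_sum => j _; case: ifP => // /sJQ ->.
have lost x : pt x = pv -> miss_in pt c Q x <= Ms x + m.
  move=> xv; rewrite /miss_in (bigID (mem J)) /= leq_add //.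
    rewrite /Ms big_mkcond [leqRHS]big_mkcond; apply: leq_sum => j _.
    by case: (j \in J); rewrite ?andbF // andbT; case: ifP.
  set N := [pred j | (j \in Q) && (j != pt x) && (j \notin J)].
  (* By [cluster_constant], two cluster parts cannot both be non-constant. *)
  have N1 : #|N| <= 1.
    apply/card_le1_eqP => i j; rewrite !inE xv.
    move=> /andP[/andP[iQ iv] niJ] /andP[/andP[jQ jv] njJ].
    apply/eqP; apply: contraT => ij.
    by case/orP: (cluster_constant jQ iQ ij) => ct; [move: njJ | move: niJ];
      rewrite ct ?iQ ?iv ?jQ ?jv.
  apply: leq_trans (_ : \sum_(j in N) m <= _); last first.
    by rewrite sum_nat_const; apply: leq_trans (leq_mul N1 (leqnn m)) _; rewrite mul1n.
  apply: leq_sum => j _; rewrite -(card_part j).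
  by apply/subset_leq_card/subsetP => y; rewrite inE => /andP[].
have step x : pt x = pv -> (Bd x <= Ms x) /\ (typical x \/ Bd x < Ms x).
  move=> xv; case: (boolP (typical x)) => [tx|/atypical_miss ntx]; last first.
    have : Bd x < Ms x by have := lost x xv; have := BdX x; move: ntx; clear; lia.
    by move=> lt; split; [apply: ltnW | right].
  split; last by left.
  rewrite [Bd x]big1 // => j /sJQ jQ; apply/eqP; rewrite cards_eq0; apply/eqP/setP => y.
  rewrite !inE /= /mono_adj; apply/negP => /and3P[/eqP yj xy /eqP cxy].
  have yX : y \in X by rewrite inE yj.
  by have := typical_indep tx (cluster_typical yX) cxy; rewrite xy.
have le1 : \sum_(x in part pt pv) Ms x <= \sum_(x in part pt pv) Bd x.
  have E : r * (\sum_(x in part pt pv) D x) + r * (\sum_(x in part pt pv) Ms x) +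
      m * (#|J| * m) = m * (r * (#|J| * m)) + r * \sum_(x in part pt pv) Bd x.
    rewrite -{1 3}(card_part pv) -!sum_nat_const !big_distrr -!big_split /=.
    by apply: eq_bigr => x _; rewrite !sum_nat_const [X in _ = X + _]mulnCA; apply: count.
  have : #|J| * ((r - 1) * m ^ 2) <= r * \sum_(x in part pt pv) D x.
    rewrite /D exchange_big /= big_distrr -sum_nat_const; apply: leq_sum => j jJ.
    by apply: dense; rewrite eq_sym; apply: nJ.
  have : #|J| * (r * m ^ 2) = #|J| * ((r - 1) * m ^ 2) + #|J| * m ^ 2.
    by rewrite m2 mulnDr.
  move=> h1 h2; rewrite -(leq_pmul2l r_gt0); move: E h1 h2; rewrite -!mulnn.
  by move: (r - 1) (\sum_(x in _) D x) (\sum_(x in _) Ms x) (\sum_(x in _) Bd x); clear; nia.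
have vp : v \in part pt pv by rewrite inE.
apply: contraT => ntv.
have : \sum_(x in part pt pv) Bd x < \sum_(x in part pt pv) Ms x.
  rewrite (bigD1 v) //= [ltnRHS](bigD1 v) //= -addSn leq_add //.
    have [_ [tv|//]] := step v erefl.
    by rewrite tv in ntv.
  apply: leq_sum => x /andP[]; rewrite inE => /eqP xv _.
  by case: (step x xv).
by rewrite ltnNge le1.
Qed.

Lemma cluster_proper u v : adj u v -> c u != c v.
Proof.
by apply: contraTneq; apply: typical_indep; apply: all_typical.
Qed.

End ClusterRigidity.

(** * The proper colouring of the whole graph *)

Lemma large_fibre (T U : finType) (f : T -> U) :
  0 < #|U| -> exists y, #|T| <= #|U| * #|[set x | f x == y]|.
Proof.
case/card_gt0P=> y0 _; have [y _ ymax] := @arg_maxnP _ y0 xpredT (fun y => #|[set x | f x == y]|) isT.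
exists y; rewrite -[leqLHS]sum1_card (partition_big f (mem U)) //= -sum_nat_const.
by apply: leq_sum => z _; rewrite sum1dep_card; apply: ymax.
Qed.

Lemma sum_dense (G : sgraph) l r m (pt : G -> 'I_l) :
  (forall i, #|part pt i| = m) ->
  (forall i j, i != j ->
    (r - 1) * m ^ 2 <= r * \sum_(v in part pt i) dg v (part pt j)) ->
  #|G| = l * m /\ (r - 1) * (#|G| * (#|G| - m)) <= r * \sum_(v : G) dg v setT.
Proof.
move=> card_part dense.
have TE : [set v | pt v \in [set: 'I_l]] = setT by apply/setP => v; rewrite !inE.
have nE : #|G| = l * m.
  by rewrite -cardsT -TE (card_cluster setT card_part) cardsT card_ord.
split=> //.
have -> : \sum_(v : G) dg v setT =
    \sum_i \sum_j \sum_(v in part pt i) dg v (part pt j).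
  transitivity (\sum_(v in [set v | pt v \in [set: 'I_l]]) dg v setT).
    by apply: eq_bigl => v; rewrite !inE.
  rewrite sum_parts; apply: eq_big => i; first by rewrite inE.
  rewrite exchange_big /= => _; apply: eq_bigr => v _; rewrite -TE dg_partition.
  by apply: eq_bigl => j; rewrite inE.
have -> : (r - 1) * (#|G| * (#|G| - m)) = l * ((l - 1) * ((r - 1) * m ^ 2)).
  rewrite nE -{3}[m]mul1n -mulnBl; move: (l - 1) (r - 1); clear; nia.
rewrite big_distrr -{1}(card_ord l) -sum_nat_const; apply: leq_sum => i _ /=.
rewrite (bigD1 i) //= mulnDr; apply: leq_trans (leq_addl _ _).
rewrite -(card_ord_neq i) -sum_nat_const big_distrr; apply: leq_sum => j ij /=.
by apply: dense; rewrite eq_sym.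
Qed.

Lemma near_colour_unique_arith r g n a b :
  1 < r -> 151 * r ^ 2 <= g -> 0 < n -> g * a <= 50 * r * n -> g * b <= 7 * n ->
  (g - 6 * r - 1) * n <= r * g * (a + b) -> False.
Proof.
move=> r_gt1 rg n_gt0 le1 le2 le3.
have le4 : (g - 6 * r - 1) * n <= (50 * r ^ 2 + 7 * r) * n.
  apply: leq_trans le3 _; have := leq_mul (leqnn r) le1; have := leq_mul (leqnn r) le2.
  rewrite -!mulnn; clear; nia.
rewrite leq_pmul2r // in le4; move: r_gt1 rg le4; rewrite -!mulnn; clear.
case: r => [|[|q]] // _; nia.
Qed.

(** The factor [r!] in [g] pays for passing to the cluster, which keeps at least [|G| / r!]
    vertices: errors of order [|G| / g] become at most [S / (2048 r^3)]. *)
Lemma proper_coloring (G : sgraph) l r s m g (pt : G -> 'I_l) :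
  1 < r -> 1 < s -> 0 < m -> g = 2048 * r ^ 3 * r`! ->
  (forall i, #|part pt i| = m) ->
  (forall x y, pt x = pt y -> ~~ adj x y) ->
  (forall i j, i != j ->
    (r - 1) * m ^ 2 <= r * \sum_(v in part pt i) dg v (part pt j)) ->
  g ^ 3 <= l ->
  3 * g ^ 2 * (((4 * r) ^ r * (g * s)) * 2 ^ (r * ((4 * r) ^ r * (g * s)))) <= #|G| ->
  ~ contains_copy G (Kplus r s) ->
  exists c : G -> 'I_r, forall u v, adj u v -> c u != c v.
Proof.
move=> r_gt1 s_gt1 m_gt0 gE card_part part_indep dense gl Mn noK.
have [nE degG] := sum_dense card_part dense.
have r_gt0 : 0 < r by apply: ltnW.
have f_gt0 := fact_gt0 r.
have g_ge : 2048 * r ^ 3 <= g by rewrite gE leq_pmulr.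
have rg : 151 * r ^ 2 <= g.
  by apply: leq_trans g_ge; rewrite (expnS r 2); move: (r ^ 2) r_gt0; clear; nia.
have g_gt0 : 0 < g by apply: leq_trans rg; rewrite muln_gt0 expn_gt0 r_gt0.
have gr : 4 * r <= g.
  by apply: leq_trans rg; rewrite -mulnn; move: r_gt0; clear; nia.
have mn : 4 * (g ^ 2 * r * m) <= #|G|.
  rewrite nE; have -> : 4 * (g ^ 2 * r * m) = g ^ 2 * (4 * r) * m by clear; lia.
  by rewrite leq_mul2r; apply/orP; right; apply: leq_trans gl; rewrite (expnSr g 2) leq_mul2l gr orbT.
have n_gt0 : 0 < #|G|.
  by apply: leq_trans mn; rewrite muln_gt0 muln_gt0 muln_gt0 expn_gt0 g_gt0 r_gt0.
have [B [rest sB mB low]] := near_extremal_structure r_gt1 s_gt1 rg degG m_gt0 mn Mn noK.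
pose c v : 'I_r := xchoose (low v).
have cP v : g * dg v (B (c v)) <= 50 * r * #|G| := xchooseP (low v).
(* A vertex of [B i] sees almost all of any other class, so only [i] can be its colour. *)
have class_colour i x : x \in B i -> c x = i.
  move=> xB; apply/eqP; apply: contraT; rewrite eq_sym => ic; exfalso.
  apply: (near_colour_unique_arith r_gt1 rg n_gt0 (cP x) (mB _ _ _ ic xB)).
  by rewrite dg_ndg; apply: sB.
have own v A : g * bad c v A <= 53 * r * #|G|.
  have : bad c v A <= dg v (B (c v)) + #|~: \bigcup_j B j|.
    apply: leq_trans (_ : #|[set x in B (c v) | adj v x] :|: ~: \bigcup_j B j| <= _).
      apply/subset_leq_card/subsetP => y; rewrite !inE /= /mono_adj.
      case/andP=> _ /andP[-> /eqP cvy]; rewrite andbT cvy.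
      case: (boolP (y \in \bigcup_j B j)) => [/bigcupP[k _ yB]|_]; last by rewrite /= ?orbT.
      by rewrite (class_colour _ _ yB) yB.
    by rewrite cardsU leq_subr.
  move: (cP v) rest r_gt1; move: (bad _ _ _) (dg _ _) #|~: _| #|G|.
  clear => b d e n le1 le2 r1 le3.
  have := leq_mul (leqnn g) le3; nia.
have p_gt0 : 0 < #|{: 'S_r}| by rewrite card_Sn.
(* Each part picks one sorting permutation; a most frequent choice defines the cluster. *)
have [p] := large_fibre (fun i => xchoose (exists_sorts (part_colour pt c i))) p_gt0.
set Q := finset _; rewrite card_ord card_Sn => lQ.
have sortsQ i : i \in Q -> sorts p (part_colour pt c i).
  by rewrite inE => /eqP <-; apply: (xchooseP (exists_sorts (part_colour pt c i))).
set S := #|Q| * m.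
have nS : #|G| <= r`! * S by rewrite nE /S mulnA leq_mul2r lQ orbT.
have cluster_large : 2048 * r ^ 3 * #|G| <= g * S.
  by rewrite gE -[leqRHS]mulnA leq_mul2l nS orbT.
have part_small : 32 * r ^ 2 * m <= S.
  rewrite leq_mul2r; apply/orP; right; rewrite -(leq_pmul2l f_gt0).
  apply: leq_trans lQ; apply: leq_trans gl; rewrite gE.
  apply: leq_trans (_ : 2048 * r ^ 3 * r`! <= _); last first.
    by rewrite -[leqLHS]expn1 leq_pexp2l // -gE.
  by rewrite mulnC leq_mul2r (expnS r 2); apply/orP; right; move: (r ^ 2) r_gt0; clear; nia.
have S_large : 8 * r * ((2 ^ r * s) * 2 ^ (r * (2 ^ r * s))) <= S.
  rewrite -(leq_pmul2l f_gt0); apply: leq_trans nS; apply: leq_trans Mn.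
  have le : 2 ^ r * s <= (4 * r) ^ r * (g * s).
    by rewrite leq_mul ?leq_exp2r ?leq_pmull //; move: r_gt0; clear; nia.
  rewrite mulnA; apply: leq_mul; last first.
    by rewrite leq_mul // leq_pexp2l // leq_mul2l le orbT.
  apply: leq_trans (_ : g <= _); last by move: g_gt0; clear; nia.
  rewrite gE mulnC leq_mul2r (expnS r 2); apply/orP; right.
  by move: r_gt0; rewrite -mulnn; clear; nia.
have bad_small v : 16 * r ^ 2 * (bad c v [set x | pt x \in Q] + m) <= S.
  have le := own v [set x | pt x \in Q].
  have : 32 * r ^ 2 * bad c v [set x | pt x \in Q] <= S.
    rewrite -(leq_pmul2l g_gt0); apply: leq_trans cluster_large.
    move: (bad _ _ _) le => b le; have := leq_mul (leqnn (32 * r ^ 2)) le.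
    rewrite !expnS expn0 muln1; clear; nia.
  by move: part_small; clear; lia.
exists c => u v; apply: (cluster_proper r_gt1 card_part part_indep dense sortsQ bad_small).
move=> x y tx ty.
apply: (typical_independent r_gt1 card_part s_gt1 g_gt0 rest mB class_colour
  cluster_large part_small S_large _ noK tx ty).
by move=> a; apply: (cluster_balance r_gt1 card_part part_indep dense bad_small).
Qed.

(** * Properly coloured graphs and the family *)

(** The complements of [A] and of its image have equal size, so their enumerations can be
    matched. *)
Lemma extend_to_perm (T : finType) (A : {set T}) (f : T -> T) :
  {in A &, injective f} -> exists p : {perm T}, {in A, p =1 f}.
Proof.
move=> f_inj; pose s := enum A ++ enum (~: A).
pose s' := map f (enum A) ++ enum (~: (f @: A)).
have us : uniq s.
  rewrite cat_uniq !enum_uniq andbT /=; apply/hasPn => x.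
  by rewrite !mem_enum inE.
have us' : uniq s'.
  rewrite cat_uniq map_inj_in_uniq ?enum_uniq ?andbT /=; last first.
    by move=> x y; rewrite !mem_enum; apply: f_inj.
  apply/hasPn => x; rewrite mem_enum inE; apply: contra => /mapP[y].
  by rewrite mem_enum => yA ->; apply: imset_f.
have sizes : size s = size s'.
  rewrite !size_cat size_map -!cardE; congr (_ + _).
  by rewrite (cardsCs (~: A)) (cardsCs (~: (f @: A))) !setCK card_in_imset.
have ins x : x \in s by rewrite mem_cat !mem_enum inE; case: (x \in A).
pose h x := nth x s' (index x s).
have h_inj : injective h.
  move=> x y; rewrite /h (set_nth_default x y); last by rewrite -sizes index_mem.
  move/eqP; rewrite nth_uniq -?sizes ?index_mem // => /eqP E.
  by rewrite -(nth_index x (ins x)) -(nth_index x (ins y)) E.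
exists (perm h_inj) => x xA; rewrite permE /h index_cat mem_enum xA nth_cat size_map.
by rewrite index_mem mem_enum xA (nth_map x) ?index_mem ?nth_index ?mem_enum.
Qed.

Section ProperColouring.

Variables (G : sgraph) (l r m : nat) (pt : G -> 'I_l) (c : G -> 'I_r).

Let colours i := part_colour pt c i.

Hypothesis r_gt0 : 0 < r.
Hypothesis m_gt0 : 0 < m.
Hypothesis card_part : forall i, #|part pt i| = m.
Hypothesis dense : forall i j, i != j ->
  (r - 1) * m ^ 2 <= r * \sum_(v in part pt i) dg v (part pt j).
Hypothesis proper : forall u v, adj u v -> c u != c v.

Lemma inner_add_miss i j : i != j ->
  r * (inner pt c i j + \sum_(v in part pt i) miss c v (part pt j)) <= m ^ 2.
Proof.
move=> ij; have := dense ij; have := pair_count c card_part i j.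
have -> : \sum_(v in part pt i) bad c v (part pt j) = 0.
  apply: big1 => v _; apply/eqP; rewrite cards_eq0; apply/eqP/setP => y.
  rewrite !inE /= /mono_adj; apply/negP => /and3P[_ vy /eqP cvy].
  by have := proper vy; rewrite cvy eqxx.
have : r * m ^ 2 = (r - 1) * m ^ 2 + m ^ 2.
  by rewrite -{3}[m ^ 2]mul1n -mulnDl subnK.
move: (\sum_(v in part pt i) dg v (part pt j)) (\sum_(v in part pt i) miss c v (part pt j)).
by move: (m ^ 2) (r - 1) (inner pt c i j); clear; nia.
Qed.

Lemma constant_part_colour i a : constant_colours (colours i) -> r * colours i a = m.
Proof.
move/constant_coloursP=> ci.
rewrite -(sum_part_colour c card_part i) -{1}(card_ord r) -sum_nat_const.
by apply: eq_bigr => b _; apply: ci.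
Qed.

(** Constant counts make [inner] exactly [m^2 / r], which uses up the bound of [inner_add_miss]. *)
Lemma constant_part_complete u v :
  constant_colours (colours (pt u)) -> pt u != pt v -> c u != c v -> adj u v.
Proof.
move=> ci uv cuv; have := inner_add_miss uv; rewrite mulnDr.
have -> : r * inner pt c (pt u) (pt v) = m ^ 2.
  rewrite big_distrr -mulnn -{2}(sum_part_colour c card_part (pt v)) big_distrr /=.
  by apply: eq_bigr => a _; rewrite mulnA (constant_part_colour a ci).
rewrite -{2}[m ^ 2]addn0 leq_add2l leqn0 muln_eq0 (gtn_eqF r_gt0) /=.
rewrite sum_nat_eq0 => /forallP/(_ u); rewrite inE eqxx /= cards_eq0 => /eqP/setP/(_ v).
by rewrite !inE eqxx eq_sym cuv /= => /negbFE.
Qed.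

Lemma nonconstant_sorts_inj i j (p : 'S_r) :
  ~~ constant_colours (colours i) -> ~~ constant_colours (colours j) ->
  sorts p (colours i) -> sorts p (colours j) -> i = j.
Proof.
move=> ni nj si sj; apply/eqP; apply: contraT => ij.
have : constant_colours (colours i) || constant_colours (colours j).
  apply: (sorts_tight_constant si sj).
  rewrite !(sum_part_colour c card_part) mulnn -/(inner pt c i j).
  by apply: leq_trans (inner_add_miss ij); rewrite leq_mul2l leq_addr orbT.
by rewrite (negPf ni) (negPf nj).
Qed.

End ProperColouring.

(** A non-constant part moves to the position that [pi] assigns to its sorting permutation;
    [nonconstant_sorts_inj] makes these positions distinct. Constant parts fill the rest and meet
    every order condition. *)
Lemma proper_colouring_Gfamily (k l m : nat) (pi : 'I_(k.-1)`! -> 'S_k.-1)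
    (G : sgraph) (pt : G -> 'I_l) (c : G -> 'I_k.-1) :
  bijective pi -> 0 < k.-1 -> 0 < m -> (k.-1)`! <= l ->
  (forall i, #|part pt i| = m) ->
  (forall x y, pt x = pt y -> ~~ adj x y) ->
  (forall i j, i != j ->
    (k.-1 - 1) * m ^ 2 <= k.-1 * \sum_(v in part pt i) dg v (part pt j)) ->
  (forall u v, adj u v -> c u != c v) ->
  exists2 H : sgraph, Gfamily l pi H & isomorphic G H.
Proof.
move=> [pi' pi'K piK'] r_gt0 m_gt0 fl card_part part_indep dense proper.
pose colours i := part_colour pt c i.
pose sg i := xchoose (exists_sorts (colours i)).
have sgP i : sorts (sg i) (colours i) := xchooseP (exists_sorts (colours i)).
pose f i := widen_ord fl (pi' (sg i)).
have f_inj : {in [set i | ~~ constant_colours (colours i)] &, injective f}.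
  move=> i j; rewrite !inE => ni nj /(congr1 val) /= /val_inj.
  move/(can_inj piK') => sij.
  apply: (nonconstant_sorts_inj r_gt0 card_part dense proper ni nj (sgP i)).
  by rewrite sij.
have [p pf] := extend_to_perm f_inj.
(* Blow-up vertices over [(j, a)] enumerate the vertices of colour [a] in the part moved to position
   [j]. *)
pose cell (j : 'I_l) (a : 'I_k.-1) := [set v in part pt ((p^-1)%g j) | c v == a].
pose n (j : 'I_l) (a : 'I_k.-1) := #|cell j a|.
pose h (x : blowup n) : G := enum_val (tagged (tagged x)).
have hP (x : blowup n) : h x \in cell (part_of x) (class_of x) by apply: enum_valP.
have pt_h x : pt (h x) = (p^-1)%g (part_of x).
  by have := hP x; rewrite !inE => /andP[/eqP].
have c_h x : c (h x) = class_of x.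
  by have := hP x; rewrite !inE => /andP[_ /eqP].
have h_inj : injective h.
  move=> x y hxy; have := pt_h x; rewrite hxy pt_h => /perm_inj.
  have := c_h x; rewrite hxy c_h.
  case: x y hxy => j [a t] [j' [a' t']]; rewrite /part_of /class_of /= => E aa' jj'.
  by subst; have /= -> := enum_val_inj E.
have v_cell v : v \in cell (p (pt v)) (c v) by rewrite !inE permK !eqxx.
pose b v : blowup n :=
  Tagged (fun i => {s & 'I_(n i s)})
    (Tagged (fun s => 'I_(n (p (pt v)) s)) (enum_rank_in (v_cell v) v)).
have bK : cancel b h by move=> v; apply: enum_rankK_in.
pose e : rel (blowup n) := fun x y => adj (h x) (h y).
have e_sym : symmetric e by move=> x y; apply: adj_sym.
have e_irr : irreflexive e by move=> x; apply: adj_irr.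
have const_late (i : 'I_l) : (k.-1)`! <= i -> constant_colours (colours ((p^-1)%g i)).
  move=> le; apply: contraT => nc; have := pf ((p^-1)%g i); rewrite inE nc permKV.
  by move/(_ isT) => E; have := ltn_ord (pi' (sg ((p^-1)%g i)));
    rewrite ltnNge -[X in _ <= X]/(val (f _)) -E le.
exists (SGraph e_sym e_irr); last first.
  exists b; first by exists h => //; apply: inj_can_sym bK h_inj.
  by move=> x y; rewrite /= /e !bK.
constructor.
- split=> [i lti a a' aa'|i le|i].
  + case: (boolP (constant_colours (colours ((p^-1)%g i)))) => [/constant_coloursP cc|nc].
      by apply: eq_leq; apply: cc.
    have -> : pi (Ordinal lti) = sg ((p^-1)%g i).
      rewrite -[RHS]piK'; congr (pi _); apply: val_inj => /=.
      have := pf ((p^-1)%g i); rewrite inE nc permKV => /(_ isT) E.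
      by rewrite {1}E.
    by move/sortsP: (sgP ((p^-1)%g i)); apply.
  + have cc := const_late i le; split=> [s s'|s]; first by move/constant_coloursP: cc; apply.
    have E : k.-1 * n i s = m := constant_part_colour card_part s cc.
    by rewrite lt0n; apply: contraTneq m_gt0 => n0; rewrite -E n0 muln0.
  + by rewrite (sum_part_colour c card_part).
- move=> x y exy; apply/andP; split.
    apply: contraTneq exy => pxy; rewrite /e; apply: part_indep.
    by rewrite !pt_h pxy.
  by rewrite -!c_h; apply: proper.
(* A missing pair cannot meet a constant part, and only constant parts sit at late positions. *)
- have late x y : Gbar_adj x y -> ~~ e x y -> part_of x < (k.-1)`!.
    case/andP=> pxy cxy; apply: contraR; rewrite -leqNgt => /const_late cc.
    apply: (constant_part_complete r_gt0 card_part dense proper).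
    - by rewrite pt_h.
    - by rewrite !pt_h (inj_eq perm_inj).
    - by rewrite !c_h.
  move=> x y xy nxy; split; first exact: late xy nxy.
  apply: (late y x); last by rewrite e_sym.
  by rewrite /Gbar_adj eq_sym (eq_sym (class_of y)).
Qed.

(** * Constants *)

Lemma fact_le_expn n m : n <= m -> n`! <= m ^ n.
Proof.
by elim: n => // n IH nm; rewrite factS expnS leq_mul // IH // ltnW.
Qed.

(** With [k = r + 1], the bounds [4 r <= k^2], [2048 <= k^7] and [r! <= k^r] give total exponent
    [3 r + 11], at most [(r + 7) (r + 1)]. *)
Lemma constant_bound k : 3 <= k ->
  k * ((4 * k.-1) ^ k.-1 * (2048 * k.-1 ^ 3 * (k.-1)`!)) <= k ^ ((k + 6) * k).
Proof.
case: k => // r r2; rewrite [r.+1.-1]/=.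
have r_gt0 : 0 < r by apply: ltnW.
have le1 : (4 * r) ^ r <= r.+1 ^ (2 * r).
  by rewrite expnM leq_exp2r //; clear; nia.
have le2 : 2048 <= r.+1 ^ 7.
  by apply: leq_trans (_ : 3 ^ 7 <= _) => //; rewrite leq_exp2r.
have le3 : r ^ 3 <= r.+1 ^ 3 by rewrite leq_exp2r.
have le4 : r`! <= r.+1 ^ r by apply: fact_le_expn.
apply: leq_trans (_ : r.+1 * (r.+1 ^ (2 * r) * (r.+1 ^ 7 * r.+1 ^ 3 * r.+1 ^ r)) <= _).
  by rewrite leq_mul // leq_mul // leq_mul // leq_mul.
rewrite -!expnD -expnS leq_pexp2l //; move: r2; clear; nia.
Qed.

(** With [Y = (4 r)^r g s], the factors bounded by [2^Y] give total exponent [2 + 3 Y + r Y], at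
    most [2 (r + 1) Y <= 2 K s]. *)
Lemma order_bounds r s g K n l : 1 < r -> 1 < s ->
  r.+1 * ((4 * r) ^ r * g) <= K -> 0 < g -> 2 ^ (4 * K) <= l -> 2 ^ (2 * (K * s)) <= n ->
  g ^ 3 <= l /\
  3 * g ^ 2 * (((4 * r) ^ r * (g * s)) * 2 ^ (r * ((4 * r) ^ r * (g * s)))) <= n.
Proof.
move=> r_gt1 s_gt1 rK g_gt0 lK nK.
have p_gt0 : 0 < (4 * r) ^ r by rewrite expn_gt0 muln_gt0 (ltnW r_gt1).
have gK : g <= K.
  by apply: leq_trans rK; rewrite mulnA leq_pmull // muln_gt0.
have g2 : g <= 2 ^ g by apply/ltnW/ltn_expl.
split.
  apply: leq_trans lK; apply: leq_trans (_ : (2 ^ g) ^ 3 <= _).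
    by rewrite leq_exp2r.
  by rewrite -expnM leq_pexp2l //; move: gK; clear; lia.
apply: leq_trans nK; set Y := (4 * r) ^ r * (g * s).
have gY : g <= Y by rewrite /Y mulnCA mulnA -mulnA leq_pmulr // muln_gt0 p_gt0 ltnW.
have Y2 : Y <= 2 ^ Y by apply/ltnW/ltn_expl.
apply: leq_trans (_ : 2 ^ 2 * (2 ^ Y) ^ 2 * (2 ^ Y * 2 ^ (r * Y)) <= _).
  apply: leq_mul; last by rewrite leq_mul2r Y2 orbT.
  by apply: leq_mul => //; rewrite leq_exp2r // (leq_trans gY).
rewrite -expnM -!expnD leq_pexp2l //.
have : r.+1 * Y <= K * s.
  by rewrite /Y [X in r.+1 * X]mulnA mulnA leq_mul2r rK orbT.
have : 2 <= Y by apply: leq_trans s_gt1 _; rewrite /Y mulnA leq_pmull // muln_gt0 p_gt0.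
have : 2 * Y <= r * Y by rewrite leq_mul2r r_gt1 orbT.
by rewrite mulSn; clear; lia.
Qed.

Local Open Scope ring_scope.

Lemma exp2_le_expR (R : realType) n : ((2 ^ n)%N%:R : R) <= expR n%:R.
Proof.
rewrite natrX -[n%:R]mulr1 expRM_natl lerXn2r ?nnegrE ?expR_ge0 //.
by apply: le_trans (expR_ge1Dx 1).
Qed.

(** [ln n >= 4 K] makes the truncated quotient at least 2, and [2 K s <= ln n] is exponentiated
    using [2 <= e]. *)
Lemma log_order_bounds (R : realType) (K n : nat) : (0 < K)%N ->
  expR (4 * K%:R) <= n%:R :> R ->
  let s := Num.truncn (K%:R^-1 / 2 * ln (n%:R : R)) in
  (1 < s)%N /\ (2 ^ (2 * (K * s)) <= n)%N.
Proof.
move=> K_gt0 Kn s; have K0 : 0 < K%:R :> R by rewrite ltr0n.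
have n0 : 0 < n%:R :> R by apply: lt_le_trans Kn; apply: expR_gt0.
have lnn : 4 * K%:R <= ln (n%:R : R).
  by rewrite -[leLHS]expRK ler_ln ?posrE ?expR_gt0.
have x2 : 2 <= K%:R^-1 / 2 * ln (n%:R : R).
  rewrite -mulrA ler_pdivlMl // ler_pdivlMl //; apply: le_trans lnn.
  by rewrite -!natrM ler_nat; clear; lia.
have x0 : 0 <= K%:R^-1 / 2 * ln (n%:R : R) by apply: le_trans x2.
split; first by rewrite truncn_ge_nat.
have : s%:R <= K%:R^-1 / 2 * ln (n%:R : R) by rewrite truncn_le.
rewrite -mulrA ler_pdivlMl // ler_pdivlMl // => le.
rewrite -(ler_nat R); apply: le_trans (exp2_le_expR _ _) _.
by rewrite -[leRHS]lnK ?posrE // ler_expR !natrM.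
Qed.

Lemma edges_between_sum (G : sgraph) (A B : {set G}) :
  edges_between A B = (\sum_(v in A) dg v B)%N.
Proof.
rewrite /edges_between -sum1_card (partition_big fst (mem A)) /=; last first.
  by move=> p; rewrite !inE => /andP[/andP[]].
apply: eq_bigr => v vA; rewrite sum1dep_card /dg.
have inj : injective (fun y : G => (v, y)) by move=> y z [].
rewrite -[RHS](card_imset _ inj).
apply: eq_card => -[x y]; rewrite !inE /=; apply/andP/imsetP.
  by case=> /andP[/andP[_ yB] xy] /eqP E; exists y; rewrite ?inE -E ?yB.
by case=> z; rewrite inE => /andP[zB vz] [-> ->]; rewrite vA zB vz.
Qed.

Lemma density_edges (R : realType) (G : sgraph) (A B : {set G}) (k m : nat) :
  (1 < k)%N -> (0 < m)%N -> #|A| = m -> #|B| = m ->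
  (k - 2)%:R / (k - 1)%:R <= density R A B ->
  ((k.-1 - 1) * m ^ 2 <= k.-1 * \sum_(v in A) dg v B)%N.
Proof.
move=> k_gt1 m_gt0 cA cB; rewrite /density cA cB -edges_between_sum.
have r0 : 0 < (k - 1)%:R :> R by rewrite ltr0n subn_gt0.
have m0 : 0 < m%:R * m%:R :> R by rewrite mulr_gt0 ?ltr0n.
rewrite ler_pdivrMr // mulrAC ler_pdivlMr // -!natrM ler_nat.
by rewrite mulnn -subn1 -subnDA mulnC [X in (_ <= X)%N]mulnC.
Qed.

Theorem theorem1p4 (R : realType) (k l : nat)
    (pi : 'I_(k.-1)`! -> 'S_k.-1) (pi_bij : bijective pi)
    (G : sgraph) (V : 'I_l -> {set G}) :
  (3 <= k)%N ->
  expR (4 * k%:R ^+ ((k + 6) * k)) <= l%:R :> R ->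
  multipartite V ->
  balanced V ->
  (forall i j, i != j -> (k - 2)%:R / (k - 1)%:R <= density R (V i) (V j)) ->
  (exists2 H : sgraph, Gfamily l pi H & isomorphic G H) \/
  contains_copy G
    (Kplus k.-1 (Num.truncn (k%:R ^- ((k + 6) * k) / 2 * ln (#|G|%:R : R)))).
Proof.
move=> k_ge3 l_large [cover disj nonempty indep] bal dens.
set s := Num.truncn _.
have [copy|noK] := boolp.EM (contains_copy G (Kplus k.-1 s)); [by right | left].
have k_gt0 : (0 < k)%N by apply: leq_trans k_ge3.
pose K := (k ^ ((k + 6) * k))%N.
have K_gt0 : (0 < K)%N by rewrite expn_gt0 k_gt0.
have KE : K%:R = k%:R ^+ ((k + 6) * k) :> R by rewrite natrX.
rewrite -KE in l_large.
have r_gt1 : (1 < k.-1)%N by rewrite -ltnS prednK.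
have l_big : (2 ^ (4 * K) <= l)%N.
  rewrite -(ler_nat R); apply: le_trans (exp2_le_expR _ _) _.
  by rewrite natrM.
have l_gt0 : (0 < l)%N by apply: leq_trans l_big; rewrite expn_gt0.
pose i0 := Ordinal l_gt0; pose m := #|V i0|.
have cardV i : #|V i| = m by apply: bal.
have m_gt0 : (0 < m)%N by rewrite card_gt0.
have inV v : exists i, v \in V i.
  by have := in_setT v; rewrite -cover => /bigcupP[i _]; exists i.
pose pt v := xchoose (inV v).
have partE i : part pt i = V i.
  apply/setP => v; rewrite inE; apply/eqP/idP => [<-|vi]; first exact: (xchooseP (inV v)).
  apply/eqP; apply: contraT => /disj/disjoint_setI0/setP/(_ v).
  by rewrite !inE vi (xchooseP (inV v)).
have card_part i : #|part pt i| = m by rewrite partE.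
have part_indep x y : pt x = pt y -> ~~ adj x y.
  move=> xy; apply: (indep (pt x)); first exact: (xchooseP (inV x)).
  by rewrite xy; apply: (xchooseP (inV y)).
have dense i j : i != j ->
    ((k.-1 - 1) * m ^ 2 <= k.-1 * \sum_(v in part pt i) dg v (part pt j))%N.
  by move=> ij; rewrite !partE; apply: density_edges (dens i j ij) => //; apply: ltnW.
(* Parts are non-empty, so the lower bound on [l] passes to [#|G|]. *)
have ln : (l <= #|G|)%N.
  have [-> _] := sum_dense card_part dense; exact: leq_pmulr.
have [s_gt1 n_big] : (1 < s)%N /\ (2 ^ (2 * (K * s)) <= #|G|)%N.
  rewrite /s -KE; apply: log_order_bounds => //.
  by apply: le_trans l_large _; rewrite ler_nat.
pose g := (2048 * k.-1 ^ 3 * (k.-1)`!)%N.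
have g_gt0 : (0 < g)%N.
  by rewrite /g muln_gt0 fact_gt0 andbT muln_gt0 expn_gt0 (ltnW r_gt1).
have rK : (k.-1.+1 * ((4 * k.-1) ^ k.-1 * g) <= K)%N.
  by rewrite prednK //; apply: constant_bound.
have [gl Mn] := order_bounds r_gt1 s_gt1 rK g_gt0 l_big n_big.
have [c proper] := proper_coloring r_gt1 s_gt1 m_gt0 (erefl g) card_part
  part_indep dense gl Mn noK.
apply: (proper_colouring_Gfamily pi_bij (ltnW r_gt1) m_gt0 _ card_part part_indep
  dense proper).
apply: leq_trans gl; apply: leq_trans (_ : g <= _)%N.
  by rewrite /g leq_pmull // muln_gt0 expn_gt0 (ltnW r_gt1).
by rewrite -{1}[g]expn1 leq_pexp2l.
Qed.
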